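(* Let $\mu$ and $\mu^*$ be the leaf distributions (distributions over $\{-1,1\}^n$) of two tree-structured Ising models, each with $n$ leaves labeled $1,\dots,n$. Assume that $|\mathbb{E}_{\mu}[x_i x_j] - \mathbb{E}_{\mu^*}[x_i x_j]| \le \epsilon$ for all pairs of distinct leaves $i,j$, and let $D$ be the minimum of the diameters of the two underlying trees. Then: (1) (Same topology) If $\mu$ and $\mu^*$ are defined on the same tree, then $\mathrm{TV}(\mu,\mu^* ) \le 2n^2\epsilon$. (2) (Different topologies) If $\mu$ and $\mu^*$ are defined on different trees, then $\mathrm{TV}(\mu,\mu^* ) \le C D n^5 \epsilon$, where $C>0$ is an absolute constant.
   Context: A tree-structured Ising model is given by an undirected tree $T=(V,E)$ whose leaves are labeled $1,\dots,n$ and whose internal nodes are labeled $n+1,\dots,n+n'$ (standing assumption: every non-leaf node has degree $3$), together with edge weights $\theta_{ij}\in[-1,1]$ for $(i,j)\in E$. Each node $i$ receives a spin $x_i\in\{-1,1\}$ with $\Pr[x_1,\dots,x_{n+n'}] \propto \prod_{(i,j)\in E} \frac{1+\theta_{ij}x_ix_j}{2}$. The leaf distribution is the marginal of this distribution on $(x_1,\dots,x_n)$. For any two nodes $i,j$, $\mathbb{E}[x_ix_j]=\prod_{(k,l)\in P_{ij}}\theta_{kl}$, where $P_{ij}$ is the path between $i$ and $j$. $\mathrm{TV}(\mu,\nu)=\frac12\sum_x|\mu(x)-\nu(x)|$. *)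

(* Defs.v *)
From mathcomp Require Import all_boot all_order all_algebra.
From mathcomp Require Import reals.
Set Implicit Arguments.
Unset Strict Implicit.
Unset Printing Implicit Defensive.
Import Order.TTheory GRing.Theory Num.Theory.
Local Open Scope ring_scope.

(* Nodes of a tree with n leaves and m internal nodes: 'I_(n + m).
   Leaf i (paper label i+1) is [lshift m i]; nodes with value >= n are the
   internal nodes (paper labels n+1, ..., n+m). *)

Section Tree.
Variables (T : finType) (e : rel T).

Definition degree (u : T) : nat := #|[set v | e u v]|.

Definition is_tree : Prop :=
  symmetric e /\ irreflexive e /\ (forall u v, connect e u v) /\
  #|[set p : T * T | e p.1 p.2]| = (2 * (#|T| - 1))%N.

Fixpoint ball (k : nat) (u : T) : {set T} :=
  match k with
  | 0 => [set u]
  | k'.+1 => ball k' u :|: [set v | [exists w in ball k' u, e w v]]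
  end.

Definition dist (u v : T) : nat :=
  \big[minn/#|T|]_(k < #|T| | v \in ball k u) k.

Definition diameter : nat := \max_(u : T) \max_(v : T) dist u v.
End Tree.

Definition leaf_tree (n m : nat) (e : rel 'I_(n + m)) : Prop :=
  is_tree e /\
  (forall i : 'I_n, degree e (lshift m i) = 1%N) /\
  (forall u : 'I_(n + m), (n <= u)%N -> degree e u = 3%N).

Definition same_tree (n m m' : nat) (e : rel 'I_(n + m)) (e' : rel 'I_(n + m'))
  : Prop :=
  exists f : 'I_(n + m) -> 'I_(n + m'),
    bijective f /\ (forall i : 'I_n, f (lshift m i) = lshift m' i) /\
    (forall u v, e' (f u) (f v) = e u v).

Section Ising.
Variable R : realType.

Definition spin (b : bool) : R := if b then 1 else -1.

Definition weights_ok (N : nat) (e : rel 'I_N) (th : 'I_N -> 'I_N -> R) : Prop :=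
  forall i j, e i j -> -1 <= th i j <= 1.

(* unnormalized weight prod_{(i,j) in E} (1 + th_ij x_i x_j)/2,
   each undirected edge {i,j} counted once as (i,j) with i < j *)
Definition ising_weight (N : nat) (e : rel 'I_N) (th : 'I_N -> 'I_N -> R)
  (x : {ffun 'I_N -> bool}) : R :=
  \prod_(p : 'I_N * 'I_N | (p.1 < p.2)%N && e p.1 p.2)
     ((1 + th p.1 p.2 * spin (x p.1) * spin (x p.2)) / 2).

Definition ising_prob (N : nat) (e : rel 'I_N) (th : 'I_N -> 'I_N -> R)
  (x : {ffun 'I_N -> bool}) : R :=
  ising_weight e th x / \sum_(z : {ffun 'I_N -> bool}) ising_weight e th z.

Definition leaf_dist (n m : nat) (e : rel 'I_(n + m))
  (th : 'I_(n + m) -> 'I_(n + m) -> R) (y : {ffun 'I_n -> bool}) : R :=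
  \sum_(x : {ffun 'I_(n + m) -> bool} | [forall i : 'I_n, x (lshift m i) == y i])
     ising_prob e th x.

Definition corr (n : nat) (mu : {ffun 'I_n -> bool} -> R) (i j : 'I_n) : R :=
  \sum_(y : {ffun 'I_n -> bool}) mu y * spin (y i) * spin (y j).

Definition TV (n : nat) (mu nu : {ffun 'I_n -> bool} -> R) : R :=
  2^-1 * \sum_(y : {ffun 'I_n -> bool}) `|mu y - nu y|.
End Ising.

(* Main.v *)
(* The marginal of an Ising tree on its leaves has density F with respect to the
   uniform distribution, where a subtree sends to its root a message F + x G
   (x the spin of the root): an edge of weight w multiplies G by w, and joining
   two subtrees multiplies their messages modulo x^2 = 1. The density is affine
   in the weight of a pendant edge, so scaling two such weights (one in each
   model) by a common factor reduces everything to the case where one of them is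
   1 or -1; discrepancies of correlations scale accordingly.
   Same topology: let i, j form a cherry. When the edge at i has weight 1 or -1
   in one model, there j is a noisy copy of i; giving j the same law in the other
   model costs at most the discrepancies of the pairs meeting i or j. Dropping
   whichever of i and j has the larger total discrepancy yields by induction an
   L1 distance at most twice the sum of all pair discrepancies.
   Arbitrary topologies: root both trees at the same leaf i. When the edge at i
   has weight 1 or -1 in one model, that model factors at i into two smaller
   ones. Forcing the same factorisation on the other model costs at most the sum
   of the covariances given x_i of the separated pairs, which vanish in the first
   model and are therefore bounded by discrepancies. By induction the L1 distance
   is at most n times the sum of the pair discrepancies, which gives a bound of
   order n^3 epsilon, without the diameter. *)
Require Import Defs.
From mathcomp Require Import all_boot all_order all_algebra.
From mathcomp Require Import reals.
From mathcomp Require Import ring lra zify.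
Set Implicit Arguments.
Unset Strict Implicit.
Unset Printing Implicit Defensive.
Import Order.TTheory GRing.Theory Num.Theory.
Local Open Scope ring_scope.

(** * Averages over the cube *)

Section Cube.
Variables (R : realType) (I : finType).
Local Notation cube := {ffun I -> bool}.
Implicit Types (h : cube -> R) (y z : cube) (A B : seq I) (i j : I).

Definition sg i y : R := spin R (y i).

Definition avg h : R := (2 ^+ #|I|)^-1 * \sum_y h y.

Definition norm1 h : R := avg (fun y => `|h y|).

Definition depends A h : Prop :=
  forall y z, (forall i, i \in A -> y i = z i) -> h y = h z.

Lemma sg_sqr i y : sg i y * sg i y = 1.
Proof. by rewrite /sg /spin; case: (y i); ring. Qed.

Lemma norm_sg i y : `|sg i y| = 1.
Proof. by rewrite /sg /spin; case: (y i); rewrite ?normrN normr1. Qed.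

Lemma sum_cube : \sum_(y : cube) (1 : R) = 2 ^+ #|I|.
Proof. by rewrite sumr_const card_ffun card_bool -natrX. Qed.

Lemma eq_avg h1 h2 : h1 =1 h2 -> avg h1 = avg h2.
Proof. by move=> eh; rewrite /avg (eq_bigr h2). Qed.

Lemma avgD h1 h2 : avg (fun y => h1 y + h2 y) = avg h1 + avg h2.
Proof. by rewrite /avg big_split mulrDr. Qed.

Lemma avgZ c h : avg (fun y => c * h y) = c * avg h.
Proof. by rewrite /avg -mulr_sumr mulrCA. Qed.

Lemma avgN h : avg (fun y => - h y) = - avg h.
Proof. by rewrite /avg sumrN mulrN. Qed.

Lemma avg_const c : avg (fun=> c) = c.
Proof.
rewrite -[in LHS](mulr1 c) avgZ /avg sum_cube mulVf ?mulr1 //.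
by rewrite expf_neq0 // pnatr_eq0.
Qed.

Lemma ler_avg h1 h2 : (forall y, h1 y <= h2 y) -> avg h1 <= avg h2.
Proof.
move=> le12; rewrite /avg ler_wpM2l ?invr_ge0 ?exprn_ge0 //.
exact: ler_sum.
Qed.

Lemma avg_ge0 h : (forall y, 0 <= h y) -> 0 <= avg h.
Proof. by move=> h0; rewrite -(avg_const 0); apply: ler_avg. Qed.

Lemma ler_norm_avg h : `|avg h| <= norm1 h.
Proof.
by rewrite ler_norml -avgN !ler_avg // => y; rewrite ?ler_norm // lerNl -normrN ler_norm.
Qed.

Lemma eq_norm1 h1 h2 : h1 =1 h2 -> norm1 h1 = norm1 h2.
Proof. by move=> eh; apply: eq_avg => y; rewrite eh. Qed.

Lemma norm1_ge0 h : 0 <= norm1 h.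
Proof. exact: avg_ge0. Qed.

Lemma norm1_0 : norm1 (fun=> 0) = 0.
Proof. by rewrite /norm1 normr0 avg_const. Qed.

Lemma norm1D h1 h2 : norm1 (fun y => h1 y + h2 y) <= norm1 h1 + norm1 h2.
Proof. by rewrite -avgD; apply: ler_avg => y; apply: ler_normD. Qed.

Lemma norm1Z c h : norm1 (fun y => c * h y) = `|c| * norm1 h.
Proof. by rewrite -avgZ; apply: eq_avg => y; rewrite normrM. Qed.

Lemma norm1_sub h1 h2 : norm1 (fun y => h1 y - h2 y) = norm1 (fun y => h2 y - h1 y).
Proof. by apply: eq_avg => y; rewrite distrC. Qed.

Lemma norm1_triangle h1 h2 h3 :
  norm1 (fun y => h1 y - h3 y) <=
  norm1 (fun y => h1 y - h2 y) + norm1 (fun y => h2 y - h3 y).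
Proof. by rewrite -avgD; apply: ler_avg => y; apply: ler_distD. Qed.

Lemma norm1_sgM i h : norm1 (fun y => sg i y * h y) = norm1 h.
Proof. by apply: eq_avg => y; rewrite normrM norm_sg mul1r. Qed.

Lemma dependsM A B h1 h2 : depends A h1 -> depends B h2 ->
  depends (A ++ B) (fun y => h1 y * h2 y).
Proof.
move=> d1 d2 y z eyz; rewrite (d1 y z) ?(d2 y z) // => i Hi;
  by rewrite eyz // mem_cat Hi ?orbT.
Qed.

Lemma dependsD A B h1 h2 : depends A h1 -> depends B h2 ->
  depends (A ++ B) (fun y => h1 y + h2 y).
Proof.
move=> d1 d2 y z eyz; rewrite (d1 y z) ?(d2 y z) // => i Hi;
  by rewrite eyz // mem_cat Hi ?orbT.
Qed.

Lemma dependsN A h : depends A h -> depends A (fun y => - h y).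
Proof. by move=> d y z eyz; rewrite (d y z). Qed.

Lemma depends_norm A h : depends A h -> depends A (fun y => `|h y|).
Proof. by move=> d y z eyz; rewrite (d y z). Qed.

Lemma dependsS A B h : {subset A <= B} -> depends A h -> depends B h.
Proof. by move=> sAB d y z eyz; apply: d => i /sAB; apply: eyz. Qed.

Lemma depends_sg i : depends [:: i] (sg i).
Proof. by move=> y z eyz; rewrite /sg eyz ?inE. Qed.

(* Swapping the coordinates in [A] between two independent copies of the cube
   turns h1 y * h2 z into h1 y' * h2 y'. *)
Lemma avg_indep A B h1 h2 : depends A h1 -> depends B h2 -> ~~ has (mem A) B ->
  avg (fun y => h1 y * h2 y) = avg h1 * avg h2.
Proof.
move=> d1 d2 /hasPn dAB.
pose mix (p : cube * cube) : cube * cube :=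
  ([ffun i => if i \in A then p.1 i else p.2 i],
   [ffun i => if i \in A then p.2 i else p.1 i]).
have mixK : involutive mix.
  by case=> y z; rewrite /mix /=; congr pair; apply/ffunP => i;
     rewrite !ffunE; case: (i \in A).
have eq1 : \sum_(p : cube * cube) h1 p.1 * h2 p.2 =
           \sum_(p : cube * cube) h1 p.1 * h2 p.1.
  rewrite [RHS](reindex_inj (inv_inj mixK)) /=; apply: eq_bigr => -[y z] _ /=.
  congr (_ * _); first by apply: d1 => i Ai; rewrite ffunE Ai.
  by apply: d2 => i /dAB /= /negbTE nA; rewrite ffunE nA.
have eq2 : \sum_(p : cube * cube) h1 p.1 * h2 p.1 = 2 ^+ #|I| * \sum_y h1 y * h2 y.
  rewrite -(pair_bigA _ (fun y _ => h1 y * h2 y)) /= mulr_sumr.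
  by apply: eq_bigr => y _; rewrite sumr_const card_ffun card_bool -natrX mulr_natl.
have eq3 : \sum_(p : cube * cube) h1 p.1 * h2 p.2 = (\sum_y h1 y) * \sum_y h2 y.
  rewrite -(pair_bigA _ (fun y z => h1 y * h2 z)) /= mulr_suml.
  by apply: eq_bigr => y _; rewrite mulr_sumr.
have n0 : (2 : R) ^+ #|I| != 0 by rewrite expf_neq0 // pnatr_eq0.
rewrite /avg; have -> : \sum_y h1 y * h2 y = (2 ^+ #|I|)^-1 * ((\sum_y h1 y) * \sum_y h2 y).
  by rewrite -eq3 eq1 eq2 mulKf.
by rewrite mulrACA !mulrA.
Qed.

Lemma norm1M_indep A B h1 h2 : depends A h1 -> depends B h2 -> ~~ has (mem A) B ->
  norm1 (fun y => h1 y * h2 y) = norm1 h1 * norm1 h2.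
Proof.
move=> d1 d2 dAB; rewrite -(avg_indep (depends_norm d1) (depends_norm d2) dAB).
by apply: eq_avg => y; rewrite normrM.
Qed.

Lemma avg_sg i : avg (sg i) = 0.
Proof.
pose flip (y : cube) : cube := [ffun k => if k == i then ~~ y k else y k].
have flipK : involutive flip.
  by move=> y; apply/ffunP => k; rewrite !ffunE; case: eqP; rewrite ?negbK.
have : avg (sg i) = - avg (sg i).
  rewrite {1}/avg (reindex_inj (inv_inj flipK)) -avgN /avg; congr (_ * _).
  apply: eq_bigr => y _; rewrite /sg ffunE eqxx /spin.
  by case: (y i); rewrite ?opprK.
move=> H; lra.
Qed.

Lemma avg_sgM A i h : depends A h -> i \notin A -> avg (fun y => sg i y * h y) = 0.
Proof.
move=> d iA; rewrite (avg_indep (@depends_sg i) d) ?avg_sg ?mul0r //.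
by apply/hasPn => j jA /=; rewrite inE; apply: contra iA => /eqP <-.
Qed.

End Cube.

(** * Weighted trees *)

(** Trees are handled through their roots: [Join] identifies two roots, [Empty] is a bare root, and
    [Leaf i] is a root that is itself the leaf [i]. The type of weights is abstract so that one
    shape can be evaluated under two weight functions. *)
Inductive wtree (I W : Type) : Type :=
| Empty
| Leaf of I
| Edge of W & wtree I W
| Join of wtree I W & wtree I W.
Arguments Empty {I W}.
Arguments Leaf {I W} i.

Fixpoint leaves (I W : Type) (t : wtree I W) : seq I :=
  match t with
  | Empty => [::]
  | Leaf i => [:: i]
  | Edge _ t => leaves t
  | Join t1 t2 => leaves t1 ++ leaves t2
  end.

Fixpoint map_tree (I W W' : Type) (h : W -> W') (t : wtree I W) : wtree I W' :=
  match t with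
  | Empty => Empty
  | Leaf i => Leaf i
  | Edge w t => Edge (h w) (map_tree h t)
  | Join t1 t2 => Join (map_tree h t1) (map_tree h t2)
  end.

(** Marginalisation on the leaves in [p]: a forgotten leaf becomes a bare root, and no edge is
    removed. *)
Fixpoint restr (I W : Type) (p : pred I) (t : wtree I W) : wtree I W :=
  match t with
  | Empty => Empty
  | Leaf i => if p i then Leaf i else Empty
  | Edge w t => Edge w (restr p t)
  | Join t1 t2 => Join (restr p t1) (restr p t2)
  end.

Lemma leaves_map (I W W' : Type) (h : W -> W') (t : wtree I W) :
  leaves (map_tree h t) = leaves t.
Proof. by elim: t => //= t1 -> t2 ->. Qed.

Lemma leaves_restr (I W : Type) p (t : wtree I W) :
  leaves (restr p t) = filter p (leaves t).
Proof.
by elim: t => //= [i | t1 -> t2 ->]; [case: (p i) | rewrite filter_cat].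
Qed.

(** * Messages and the correlations they determine *)

Section Message.
Variables (R : realType) (I : finType) (W : Type) (v : W -> R).
Local Notation cube := {ffun I -> bool}.
Local Notation tree := (wtree I W).
Implicit Types (t s : tree) (y : cube) (i j k : I).

(* Given the spin x of the root, the leaf spins y have density
   (msg t y).1 + x * (msg t y).2 with respect to the uniform distribution. *)
Fixpoint msg t y : R * R :=
  match t with
  | Empty => (1, 0)
  | Leaf i => (1, sg R i y)
  | Edge w t => ((msg t y).1, v w * (msg t y).2)
  | Join t1 t2 =>
      ((msg t1 y).1 * (msg t2 y).1 + (msg t1 y).2 * (msg t2 y).2,
       (msg t1 y).1 * (msg t2 y).2 + (msg t1 y).2 * (msg t2 y).1)
  end.

Definition F t y : R := (msg t y).1.
Definition G t y : R := (msg t y).2.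

Fixpoint bounded t : bool :=
  match t with
  | Empty | Leaf _ => true
  | Edge w t => (`|v w| <= 1) && bounded t
  | Join t1 t2 => bounded t1 && bounded t2
  end.

(** With a uniform root spin, [al t i j] is the correlation of two leaves and [ga t i] that of a
    leaf with the root. *)
Definition al t i j : R := avg (fun y => F t y * (sg R i y * sg R j y)).
Definition ga t i : R := avg (fun y => G t y * sg R i y).

Lemma F_Join t1 t2 y : F (Join t1 t2) y = F t1 y * F t2 y + G t1 y * G t2 y.
Proof. by []. Qed.
Lemma G_Join t1 t2 y : G (Join t1 t2) y = F t1 y * G t2 y + G t1 y * F t2 y.
Proof. by []. Qed.
Lemma F_Edge w t y : F (Edge w t) y = F t y. Proof. by []. Qed.
Lemma G_Edge w t y : G (Edge w t) y = v w * G t y. Proof. by []. Qed.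

Lemma bounded_restr p t : bounded t -> bounded (restr p t).
Proof.
elim: t => //= [i | w t IH /andP[-> /IH] | t1 IH1 t2 IH2 /andP[/IH1 -> /IH2]] //.
by case: (p i).
Qed.

Lemma depends_FG t : depends (leaves t) (F t) /\ depends (leaves t) (G t).
Proof.
elim: t => //= [i | w t [dF dG] | t1 [dF1 dG1] t2 [dF2 dG2]].
- by split=> //; apply: depends_sg.
- split=> // y z eyz; rewrite !G_Edge (dG y z) //.
- split=> y z eyz; rewrite ?F_Join ?G_Join.
    by rewrite (dF1 y z) ?(dF2 y z) ?(dG1 y z) ?(dG2 y z) // => i Hi;
      apply: eyz; rewrite mem_cat Hi ?orbT.
  by rewrite (dF1 y z) ?(dF2 y z) ?(dG1 y z) ?(dG2 y z) // => i Hi;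
      apply: eyz; rewrite mem_cat Hi ?orbT.
Qed.

Lemma depends_F t : depends (leaves t) (F t).
Proof. by have [] := depends_FG t. Qed.
Lemma depends_G t : depends (leaves t) (G t).
Proof. by have [] := depends_FG t. Qed.

(** Under [Join] the conditional densities [F + G] and [F - G] multiply separately, so both stay
    nonnegative; an edge only shrinks [G]. *)
Lemma norm_G_le t y : bounded t -> `|G t y| <= F t y.
Proof.
elim: t => //= [_ | i _ | w t IH /andP[vw /IH le] | t1 IH1 t2 IH2 /andP[/IH1 le1 /IH2 le2]].
- by rewrite normr0 ler01.
- by rewrite norm_sg.
- rewrite G_Edge F_Edge normrM (le_trans _ le) // ler_piMl //.
- rewrite F_Join G_Join; move: le1 le2; rewrite !ler_norml => /andP[a b] /andP[c d].
  apply/andP; split.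
    have : 0 <= (F t1 y + G t1 y) * (F t2 y + G t2 y) by rewrite mulr_ge0 //; lra.
    lra.
  have : 0 <= (F t1 y - G t1 y) * (F t2 y - G t2 y) by rewrite mulr_ge0 //; lra.
  lra.
Qed.

Lemma disjoint_consl (A B : seq I) i : ~~ has (mem A) B -> i \notin B ->
  ~~ has (mem (i :: A)) B.
Proof.
move=> /hasPn dAB iB; apply/hasPn => j jB /=; rewrite inE negb_or dAB // andbT.
by apply: contra iB => /eqP <-.
Qed.

Lemma disjointC (A B : seq I) : ~~ has (mem A) B -> ~~ has (mem B) A.
Proof. by move=> /hasPn d; apply/hasPn => i /= iA; apply: contraL iA => /d. Qed.

Lemma depends_cons (A : seq I) i (h : cube -> R) : depends A h ->
  depends (i :: A) (fun y => sg R i y * h y).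
Proof. by move=> d; apply: (dependsM (@depends_sg R I i) d). Qed.

(** Subtrees with disjoint leaves are independent under the uniform distribution, so averages of
    products split; the vanishing average of [G] removes the cross terms in the other two claims. *)
Lemma avg_FG t : uniq (leaves t) ->
  [/\ avg (F t) = 1, avg (G t) = 0 & forall i, avg (fun y => sg R i y * F t y) = 0].
Proof.
elim: t => /= [_ | j _ | w t IH /IH [aF aG aFi] | t1 IH1 t2 IH2].
- split; try by rewrite /F /G /= avg_const.
  by move=> i; apply: (avg_sgM (A := [::])).
- split; first by rewrite /F /= avg_const.
    exact: avg_sg.
  by move=> i; apply: (avg_sgM (A := [::])).
- by split=> //; rewrite (eq_avg (G_Edge w t)) avgZ aG mulr0.
rewrite cat_uniq => /and3P[/IH1 [F1 G1 Fi1] d /IH2 [F2 G2 Fi2]].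
have dC := disjointC d.
split.
- rewrite (eq_avg (F_Join t1 t2)) avgD.
  rewrite (avg_indep (@depends_F t1) (@depends_F t2)) //.
  rewrite (avg_indep (@depends_G t1) (@depends_G t2)) //.
  by rewrite F1 F2 G1 mul0r mul1r addr0.
- rewrite (eq_avg (G_Join t1 t2)) avgD.
  rewrite (avg_indep (@depends_F t1) (@depends_G t2)) //.
  rewrite (avg_indep (@depends_G t1) (@depends_F t2)) //.
  by rewrite G1 G2 mul0r mulr0 addr0.
move=> i; case: (boolP (i \in leaves t2)) => i2; last first.
  rewrite (eq_avg (h2 := fun y => (sg R i y * F t1 y) * F t2 y + (sg R i y * G t1 y) * G t2 y)).
    rewrite avgD; have d' := disjoint_consl d i2.
    rewrite (avg_indep (depends_cons (i:=i) (@depends_F t1)) (@depends_F t2)) //.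
    rewrite (avg_indep (depends_cons (i:=i) (@depends_G t1)) (@depends_G t2)) //.
    by rewrite Fi1 G2 mul0r mulr0 addr0.
  by move=> y; rewrite F_Join; ring.
rewrite (eq_avg (h2 := fun y => (sg R i y * F t2 y) * F t1 y + (sg R i y * G t2 y) * G t1 y)).
  have i1 : i \notin leaves t1 by apply: (hasPn d).
  rewrite avgD; have d' := disjoint_consl dC i1.
  rewrite (avg_indep (depends_cons (i:=i) (@depends_F t2)) (@depends_F t1)) //.
  rewrite (avg_indep (depends_cons (i:=i) (@depends_G t2)) (@depends_G t1)) //.
  by rewrite Fi2 G1 mul0r mulr0 addr0.
by move=> y; rewrite F_Join; ring.
Qed.

Lemma norm1_F t : bounded t -> uniq (leaves t) -> norm1 (F t) = 1.
Proof.
move=> b u; have [<- _ _] := avg_FG u; apply: eq_avg => y.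
by rewrite ger0_norm // (le_trans _ (norm_G_le y b)).
Qed.

Lemma norm1_G_le1 t : bounded t -> uniq (leaves t) -> norm1 (G t) <= 1.
Proof.
move=> b u; have [<- _ _] := avg_FG u; apply: ler_avg => y; exact: norm_G_le.
Qed.

Lemma ga_Edge w t i : ga (Edge w t) i = v w * ga t i.
Proof. by rewrite -avgZ; apply: eq_avg => y; rewrite G_Edge mulrA. Qed.

Lemma al_Edge w t i j : al (Edge w t) i j = al t i j.
Proof. by []. Qed.

Lemma al_sym t i j : al t i j = al t j i.
Proof. by apply: eq_avg => y; ring. Qed.

Lemma al_JoinC t1 t2 i j : al (Join t1 t2) i j = al (Join t2 t1) i j.
Proof. by apply: eq_avg => y; rewrite !F_Join; ring. Qed.

Lemma ga_JoinC t1 t2 i : ga (Join t1 t2) i = ga (Join t2 t1) i.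
Proof. by apply: eq_avg => y; rewrite !G_Join; ring. Qed.

Lemma ga_JoinL t1 t2 i : uniq (leaves t1 ++ leaves t2) -> i \notin leaves t2 ->
  ga (Join t1 t2) i = ga t1 i.
Proof.
rewrite cat_uniq => /and3P[u1 d u2] i2.
have [_ _ Fi1] := avg_FG u1; have [F2 G2 _] := avg_FG u2.
rewrite [LHS](eq_avg (h2 := fun y => (sg R i y * F t1 y) * G t2 y + (sg R i y * G t1 y) * F t2 y)).
  rewrite avgD; have d' := disjoint_consl d i2.
  rewrite (avg_indep (depends_cons (i:=i) (@depends_F t1)) (@depends_G t2)) //.
  rewrite (avg_indep (depends_cons (i:=i) (@depends_G t1)) (@depends_F t2)) //.
  rewrite G2 F2 mulr0 add0r mulr1; apply: eq_avg => y; exact: mulrC.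
by move=> y; rewrite G_Join; ring.
Qed.

Lemma al_JoinL t1 t2 i j : uniq (leaves t1 ++ leaves t2) ->
  i \notin leaves t2 -> j \notin leaves t2 -> al (Join t1 t2) i j = al t1 i j.
Proof.
rewrite cat_uniq => /and3P[u1 d u2] i2 j2.
have [F2 G2 _] := avg_FG u2.
have d' := disjoint_consl (disjoint_consl d j2) i2.
rewrite [LHS](eq_avg (h2 := fun y => (sg R i y * (sg R j y * F t1 y)) * F t2 y
   + (sg R i y * (sg R j y * G t1 y)) * G t2 y)).
  rewrite avgD.
  rewrite (avg_indep (depends_cons (i:=i) (depends_cons (i:=j) (@depends_F t1))) (@depends_F t2)) //.
  rewrite (avg_indep (depends_cons (i:=i) (depends_cons (i:=j) (@depends_G t1))) (@depends_G t2)) //.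
  rewrite G2 F2 mulr0 addr0 mulr1; apply: eq_avg => y; ring.
by move=> y; rewrite F_Join; ring.
Qed.

(** Given the root the two sides are independent. The term with both [F] vanishes because single
    spins have mean zero, and the term with both [G] survives. *)
Lemma al_JoinX t1 t2 i j : uniq (leaves t1 ++ leaves t2) ->
  i \notin leaves t2 -> j \notin leaves t1 -> i != j ->
  al (Join t1 t2) i j = ga t1 i * ga t2 j.
Proof.
rewrite cat_uniq => /and3P[u1 d u2] i2 j1 ij.
have [_ _ Fi1] := avg_FG u1.
have d' : ~~ has (mem (i :: leaves t1)) (j :: leaves t2).
  apply: disjointC; apply: disjoint_consl.
    by apply: disjointC; apply: disjoint_consl.
  by rewrite inE negb_or eq_sym ij.
rewrite [LHS](eq_avg (h2 := fun y => (sg R i y * F t1 y) * (sg R j y * F t2 y)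
   + (sg R i y * G t1 y) * (sg R j y * G t2 y))).
  rewrite avgD.
  rewrite (avg_indep (depends_cons (i:=i) (@depends_F t1)) (depends_cons (i:=j) (@depends_F t2))) //.
  rewrite (avg_indep (depends_cons (i:=i) (@depends_G t1)) (depends_cons (i:=j) (@depends_G t2))) //.
  rewrite Fi1 mul0r add0r; congr (_ * _); apply: eq_avg => y; exact: mulrC.
by move=> y; rewrite F_Join; ring.
Qed.

Lemma al_diag t i : uniq (leaves t) -> al t i i = 1.
Proof.
move=> u; have [<- _ _] := avg_FG u; apply: eq_avg => y; by rewrite sg_sqr mulr1.
Qed.

Lemma ga_Leaf i : ga (Leaf i) i = 1.
Proof. by rewrite /ga (eq_avg (h2 := fun=> 1)) ?avg_const // => y; rewrite sg_sqr. Qed.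

Lemma ga_le1 t i : bounded t -> uniq (leaves t) -> `|ga t i| <= 1.
Proof.
move=> b u; apply: le_trans (ler_norm_avg _) _.
rewrite (eq_norm1 (h2 := fun y => sg R i y * G t y)); last by move=> y; rewrite mulrC.
by rewrite norm1_sgM norm1_G_le1.
Qed.

Lemma uniq_catL (A B : seq I) i : uniq (A ++ B) -> i \in A -> i \notin B.
Proof. by rewrite cat_uniq => /and3P[_ /hasPn d _] iA; apply: contraL iA => /d. Qed.

Lemma uniq_catR (A B : seq I) i : uniq (A ++ B) -> i \in B -> i \notin A.
Proof. by rewrite cat_uniq => /and3P[_ /hasPn d _] /d. Qed.

Lemma uniq_cat_neq (A B : seq I) i j : uniq (A ++ B) -> i \in A -> j \in B -> i != j.
Proof. by move=> u iA jB; apply: contraTneq iA => ->; apply: uniq_catR u jB. Qed.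

(** In a join each [G] is multiplied by an independent density [F] of norm 1, so the influence of
    the root is subadditive down to the single leaves. *)
Lemma norm1_G_sum t : bounded t -> uniq (leaves t) ->
  norm1 (G t) <= \sum_(k <- leaves t) `|ga t k|.
Proof.
elim: t => [_ _ | i _ _ | w t IH /= /andP[vw b] u | t1 IH1 t2 IH2 /= /andP[b1 b2] u].
- by rewrite big_nil norm1_0.
- by rewrite big_seq1 ga_Leaf normr1 norm1_G_le1.
- rewrite (eq_norm1 (G_Edge w t)) norm1Z (eq_bigr (fun k => `|v w| * `|ga t k|)).
    by rewrite -mulr_sumr ler_wpM2l // IH.
  by move=> k _; rewrite ga_Edge normrM.
have u' := u; move: u'; rewrite cat_uniq => /and3P[u1 d u2].
rewrite (eq_norm1 (G_Join t1 t2)).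
apply: le_trans (norm1D _ _) _.
rewrite (norm1M_indep (@depends_F t1) (@depends_G t2)) //.
rewrite (norm1M_indep (@depends_G t1) (@depends_F t2)) //.
rewrite !norm1_F // mul1r mulr1 big_cat /= [X in X <= _]addrC.
apply: lerD.
  rewrite (eq_big_seq (fun k => `|ga t1 k|)) ?IH1 // => k k1.
  by rewrite ga_JoinL // (uniq_catL u k1).
rewrite (eq_big_seq (fun k => `|ga t2 k|)) ?IH2 // => k k2.
by rewrite ga_JoinC ga_JoinL // ?(uniq_catR u k2) // uniq_catC.
Qed.

End Message.
Arguments F {R I W} v t y.
Arguments G {R I W} v t y.

Lemma msg_map (R : realType) (I : finType) (W W' : Type) (h : W -> W') (v : W' -> R)
    (t : wtree I W) y :
  msg v (map_tree h t) y = msg (v \o h) t y.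
Proof. by elim: t => //= [w t -> | t1 -> t2 ->]. Qed.

Lemma bounded_map (R : realType) (I : finType) (W W' : Type) (h : W -> W') (v : W' -> R)
    (t : wtree I W) :
  bounded v (map_tree h t) = bounded (v \o h) t.
Proof. by elim: t => //= [w t -> | t1 -> t2 ->]. Qed.

(** * Wedging a tree along a bipartition of its leaves *)

Section Wedge.
Variables (R : realType) (I : finType) (W : Type) (v : W -> R).
Local Notation cube := {ffun I -> bool}.
Local Notation tree := (wtree I W).
Implicit Types (t s : tree) (y : cube) (i j k r : I) (p : pred I) (xi : cube -> R).

Lemma ga_restr p t i : uniq (leaves t) -> i \in leaves t -> p i ->
  ga v (restr p t) i = ga v t i.
Proof.
elim: t => //= [j | w t IH | t1 IH1 t2 IH2].
- by rewrite inE => _ /eqP -> ->.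
- by move=> u it pi; rewrite !ga_Edge IH.
move=> u; have u' := u; move: u'; rewrite cat_uniq => /and3P[u1 d u2].
have ur : uniq (leaves (restr p t1) ++ leaves (restr p t2)).
  by rewrite !leaves_restr -filter_cat filter_uniq.
rewrite mem_cat => /orP[it|it] pi.
  have it' := uniq_catL u it.
  rewrite ga_JoinL ?IH1 //; last by rewrite leaves_restr mem_filter (negbTE it') andbF.
  by rewrite ga_JoinL.
have it' := uniq_catR u it.
rewrite ga_JoinC ga_JoinL ?IH2 // 1?uniq_catC //; last by rewrite leaves_restr mem_filter (negbTE it') andbF.
by rewrite ga_JoinC ga_JoinL // uniq_catC.
Qed.

Lemma al_restr p t i j : uniq (leaves t) -> i \in leaves t -> j \in leaves t ->
  p i -> p j -> al v (restr p t) i j = al v t i j.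
Proof.
elim: t => //= [k | t1 IH1 t2 IH2].
- by rewrite !inE => _ /eqP -> /eqP -> ->.
move=> u; have u' := u; move: u'; rewrite cat_uniq => /and3P[u1 d u2].
have uC : uniq (leaves t2 ++ leaves t1) by rewrite uniq_catC.
have ur : uniq (leaves (restr p t1) ++ leaves (restr p t2)).
  by rewrite !leaves_restr -filter_cat filter_uniq.
have urC : uniq (leaves (restr p t2) ++ leaves (restr p t1)) by rewrite uniq_catC.
have notin k t : k \notin leaves t -> k \notin leaves (restr p t).
  by rewrite leaves_restr mem_filter negb_and orbC => ->.
rewrite !mem_cat => /orP[it|it] /orP[jt|jt] pi pj.
- have it' := uniq_catL u it; have jt' := uniq_catL u jt.
  by rewrite !al_JoinL ?IH1 ?notin.
- have it' := uniq_catL u it; have jt' := uniq_catR u jt.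
  have ij := uniq_cat_neq u it jt.
  by rewrite !al_JoinX ?notin // !ga_restr.
- have it' := uniq_catR u it; have jt' := uniq_catL u jt.
  have ij := uniq_cat_neq uC it jt.
  by rewrite al_JoinC [RHS]al_JoinC !al_JoinX ?notin // !ga_restr.
- have it' := uniq_catR u it; have jt' := uniq_catR u jt.
  by rewrite al_JoinC [RHS]al_JoinC !al_JoinL ?IH2 ?notin.
Qed.

(** The density of the leaves of [t] when the root spin is prescribed to be [xi y]. *)
Definition J t xi y : R := F v t y + xi y * G v t y.

(** A root spin determined by the leaf [r] alone. Besides [sg R r] its negation must be allowed,
    since an edge may flip the spin. *)
Definition is_sign r xi := depends [:: r] xi /\ forall y, xi y * xi y = 1.

Lemma is_sign_sg r : is_sign r (sg R r).
Proof. by split; [apply: depends_sg | apply: sg_sqr]. Qed.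

Lemma is_signN r xi : is_sign r xi -> is_sign r (fun y => - xi y).
Proof. by case=> d s; split; [apply: dependsN | move=> y; rewrite mulrNN]. Qed.

Lemma norm_sign r xi y : is_sign r xi -> `|xi y| = 1.
Proof.
move=> [_ /(_ y)] s; have : `|xi y| * `|xi y| = 1 by rewrite -normrM s normr1.
by move/eqP; rewrite -expr2 sqrp_eq1 // => /eqP.
Qed.

Lemma depends_J r t xi : is_sign r xi -> depends (r :: leaves t) (J t xi).
Proof.
move=> [d _]; apply: (@dependsS _ _ (leaves t ++ ([:: r] ++ leaves t))).
  by move=> i; rewrite !mem_cat !inE; case: (i \in leaves t); rewrite ?orbT ?orbF.
by apply: dependsD (@depends_F _ _ _ v t) (dependsM d (@depends_G _ _ _ v t)).
Qed.

Lemma J_ge0 r t xi y : is_sign r xi -> bounded v t -> 0 <= J t xi y.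
Proof.
move=> s b; have := norm_G_le y b; rewrite -[`|G v t y|]mul1r -(norm_sign y s) -normrM.
rewrite ler_norml /J => /andP[h _]; lra.
Qed.

(** Given the coordinates in [B], among them [r], the factor [J t xi] is a probability density on
    the leaves of [t] and integrates to 1. *)
Lemma avg_JM r t xi (B : seq I) (h : cube -> R) : is_sign r xi -> uniq (leaves t) ->
  r \in B -> depends B h -> ~~ has (mem (leaves t)) B ->
  avg (fun y => J t xi y * h y) = avg h.
Proof.
move=> s u rB d dis; have [aF aG _] := avg_FG v u.
rewrite (eq_avg (h2 := fun y => F v t y * h y + G v t y * (xi y * h y))).
  rewrite avgD (avg_indep (@depends_F _ _ _ v t) d) //.
  have d' : depends B (fun y => xi y * h y).
    apply: (@dependsS _ _ ([:: r] ++ B)); last exact: dependsM s.1 d.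
    by move=> i; rewrite mem_cat inE => /orP[/eqP ->|].
  by rewrite (avg_indep (@depends_G _ _ _ v t) d') // aF aG mul1r mul0r addr0.
by move=> y; rewrite /J; ring.
Qed.

Lemma norm1_JM r t xi (B : seq I) (h : cube -> R) : is_sign r xi -> bounded v t ->
  uniq (leaves t) -> r \in B -> depends B h -> ~~ has (mem (leaves t)) B ->
  norm1 (fun y => J t xi y * h y) = norm1 h.
Proof.
move=> s b u rB d dis; rewrite [RHS]/norm1 -(avg_JM s u rB (depends_norm d) dis).
by apply: eq_avg => y; rewrite normrM ger0_norm // (J_ge0 _ s).
Qed.

Lemma J_Join r t1 t2 xi y : is_sign r xi ->
  J (Join t1 t2) xi y = J t1 xi y * J t2 xi y.
Proof.
move=> [_ /(_ y) s]; rewrite /J F_Join G_Join.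
transitivity (F v t1 y * F v t2 y + (xi y * xi y) * (G v t1 y * G v t2 y) +
   xi y * (F v t1 y * G v t2 y + G v t1 y * F v t2 y)); first by rewrite s; ring.
by ring.
Qed.

(** Makes the leaves inside and outside [p] conditionally independent given the root, keeping the
    conditional law of each group. *)
Definition wedge_tree p t := Join (restr p t) (restr (predC p) t).

Lemma mem_leaves_wedge p t i : (i \in leaves (wedge_tree p t)) = (i \in leaves t).
Proof. by rewrite /= !leaves_restr mem_cat !mem_filter /= -andb_orl orbN. Qed.

Lemma uniq_leaves_wedge p t : uniq (leaves t) -> uniq (leaves (wedge_tree p t)).
Proof.
move=> u; rewrite /= !leaves_restr cat_uniq !filter_uniq ?andbT //=.
by apply/hasPn => i; rewrite !mem_filter /= => /andP[/negbTE ->].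
Qed.

(* For conditional spins given the root, [excess] sums the absolute values of
   the covariances al k l - ga k * ga l over the pairs that [p] separates. *)
Definition excess p t : R :=
  \sum_(k <- leaves t | p k) \sum_(l <- leaves t | ~~ p l)
    (`|al v t k l| - `|ga v t k| * `|ga v t l|).

(** A pair split between [t1] and [t2] is conditionally independent given the root: [al k l] equals
    [ga k * ga l], and the pair contributes nothing. *)
Lemma excess_Join p t1 t2 : uniq (leaves (Join t1 t2)) ->
  excess p (Join t1 t2) = excess p t1 + excess p t2.
Proof.
move=> /= u; rewrite /excess /=.
have uC : uniq (leaves t2 ++ leaves t1) by rewrite uniq_catC.
have E1 k : k \in leaves t1 -> p k -> 
  \sum_(l <- leaves t1 ++ leaves t2 | ~~ p l) (`|al v (Join t1 t2) k l| -
     `|ga v (Join t1 t2) k| * `|ga v (Join t1 t2) l|) =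
  \sum_(l <- leaves t1 | ~~ p l) (`|al v t1 k l| - `|ga v t1 k| * `|ga v t1 l|).
  move=> k1 pk; rewrite big_cat /= [X in _ + X]big1_seq ?addr0; last first.
    move=> l /andP[pl l2]; rewrite al_JoinX ?(uniq_catL u k1) ?(uniq_catR u l2) ?(uniq_cat_neq u k1 l2) //.
    rewrite ga_JoinL ?(uniq_catL u k1) // ga_JoinC ga_JoinL ?(uniq_catR u l2) //.
    by rewrite normrM subrr.
  rewrite [LHS]big_seq_cond [RHS]big_seq_cond; apply: eq_bigr => l /andP[l1 _].
  by rewrite al_JoinL ?ga_JoinL ?(uniq_catL u k1) ?(uniq_catL u l1).
have E2 k : k \in leaves t2 -> p k -> 
  \sum_(l <- leaves t1 ++ leaves t2 | ~~ p l) (`|al v (Join t1 t2) k l| -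
     `|ga v (Join t1 t2) k| * `|ga v (Join t1 t2) l|) =
  \sum_(l <- leaves t2 | ~~ p l) (`|al v t2 k l| - `|ga v t2 k| * `|ga v t2 l|).
  move=> k2 pk; rewrite big_cat /= [X in X + _]big1_seq ?add0r; last first.
    move=> l /andP[pl l1]; rewrite al_JoinC al_JoinX ?(uniq_catL uC k2) ?(uniq_catR uC l1) ?(uniq_cat_neq uC k2 l1) //.
    rewrite ga_JoinC ga_JoinL ?(uniq_catL uC k2) // ga_JoinC ga_JoinC ga_JoinL ?(uniq_catR uC l1) //.
    by rewrite normrM subrr.
  rewrite [LHS]big_seq_cond [RHS]big_seq_cond; apply: eq_bigr => l /andP[l2 _].
  by rewrite al_JoinC !(ga_JoinC _ t1 t2) al_JoinL ?ga_JoinL ?(uniq_catL uC k2) ?(uniq_catL uC l2).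
rewrite [LHS]big_cat /=; congr (_ + _).
  rewrite [LHS]big_seq_cond [RHS]big_seq_cond; apply: eq_bigr => k /andP[k1 pk]; exact: E1.
rewrite [LHS]big_seq_cond [RHS]big_seq_cond; apply: eq_bigr => k /andP[k1 pk]; exact: E2.
Qed.

(** Induction on the tree: an edge is a random flip of the root spin plus one explicit correction,
    and in a join the branches are replaced one at a time. *)
Lemma wedge p r t xi : bounded v t -> uniq (leaves t) -> is_sign r xi ->
  r \notin leaves t ->
  norm1 (fun y => J t xi y - J (wedge_tree p t) xi y) <= excess p t.
Proof.
elim: t xi => [xi _ _ _ _ | i xi _ _ s ri | w t IH xi /= /andP[vw b] u s rt
              | t1 IH1 t2 IH2 xi /= /andP[b1 b2] u s].
- rewrite /excess /= big_nil (eq_norm1 (h2 := fun=> 0)) ?norm1_0 // => y.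
  by rewrite /J /F /G /=; ring.
- rewrite (eq_norm1 (h2 := fun=> 0)); last first.
    by move=> y; rewrite /J /F /G /=; case: (p i) => /=; ring.
  rewrite norm1_0 /excess /= big_seq_cond big1 // => k.
  rewrite inE => /andP[/eqP -> pi]; rewrite big_seq_cond big1 // => l.
  by rewrite inE => /andP[/eqP ->]; rewrite pi.
- have s' := is_signN s.
  have := IH _ b u s rt; have := IH _ b u s' rt => H1 H2.
  set w' := v w in vw *.
  pose K := restr p t; pose L := restr (predC p) t.
  pose D x y := J t x y - J (wedge_tree p t) x y.
  have uKL := uniq_leaves_wedge p u.
  have /and3P[uK dKL uL] : [&& uniq (leaves K), ~~ has (mem (leaves K)) (leaves L) & uniq (leaves L)].
    by rewrite -cat_uniq.
  (* The edge passes on [xi] with probability (1 + w')/2 and its negation otherwise. Mixing the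
     wedges of [t] leaves the product of the two [G] with coefficient 1, whereas the wedge of the
     whole tree has w'^2; hence the last term. *)
  have -> : norm1 (fun y => J (Edge w t) xi y - J (wedge_tree p (Edge w t)) xi y) =
     norm1 (fun y => ((1 + w') / 2 * D xi y + (1 - w') / 2 * D (fun z => - xi z) y) +
         (1 - w' ^+ 2) * (G v K y * G v L y)).
    apply: eq_norm1 => y; rewrite /D /J /wedge_tree /= !F_Join !G_Join !F_Edge !G_Edge -/w' -/K -/L.
    by field.
  move: vw; rewrite ler_norml => /andP[w1 w2].
  have w21 : w' ^+ 2 <= 1 by rewrite -(real_normK (num_real w')) expr_le1 // ler_norml w1.
  apply: le_trans (norm1D _ _) _.
  rewrite norm1Z (norm1M_indep (@depends_G _ _ _ v K) (@depends_G _ _ _ v L)) //.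
  rewrite ger0_norm ?subr_ge0 //.
  have bK : bounded v K by apply: bounded_restr.
  have bL : bounded v L by apply: bounded_restr.
  have HG : norm1 (G v K) * norm1 (G v L) <=
     \sum_(k <- leaves t | p k) \sum_(l <- leaves t | ~~ p l) `|ga v t k| * `|ga v t l|.
    rewrite (eq_bigr (fun k => `|ga v t k| * \sum_(l <- leaves t | ~~ p l) `|ga v t l|)); last first.
      by move=> k _; rewrite mulr_sumr.
    rewrite -mulr_suml; apply: ler_pM; rewrite ?norm1_ge0 //.
      apply: le_trans (norm1_G_sum bK uK) _.
      rewrite leaves_restr big_filter [X in X <= _]big_seq_cond [X in _ <= X]big_seq_cond.
      by apply: ler_sum => k /andP[kt pk]; rewrite ga_restr.
    apply: le_trans (norm1_G_sum bL uL) _.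
    rewrite leaves_restr big_filter [X in X <= _]big_seq_cond [X in _ <= X]big_seq_cond.
    by apply: ler_sum => k /andP[kt pk]; rewrite ga_restr.
  (* [al] ignores the edge and each [ga] is multiplied by w', so the excess grows by exactly what
     [HG] allows for the correction. *)
  have -> : excess p (Edge w t) = excess p t + (1 - w' ^+ 2) *
     \sum_(k <- leaves t | p k) \sum_(l <- leaves t | ~~ p l) `|ga v t k| * `|ga v t l|.
    rewrite /excess mulr_sumr -big_split /=; apply: eq_bigr => k _.
    rewrite mulr_sumr -big_split /=; apply: eq_bigr => l _.
    rewrite al_Edge !ga_Edge -/w' !normrM -(real_normK (num_real w')); ring.
  apply: lerD; last by rewrite ler_wpM2l // subr_ge0.
  apply: le_trans (norm1D _ _) _; rewrite !norm1Z !ger0_norm; try lra.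
  have -> : excess p t = (1 + w') / 2 * excess p t + (1 - w') / 2 * excess p t by field.
  by apply: lerD; rewrite ler_wpM2l //; lra.
rewrite mem_cat negb_or => /andP[r1 r2].
rewrite excess_Join //.
have u' := u; move: u'; rewrite cat_uniq => /and3P[u1 d u2].
pose S1 := wedge_tree p t1; pose S2 := wedge_tree p t2.
have bS1 : bounded v S1 by rewrite /= !bounded_restr.
have uS1 : uniq (leaves S1) by exact: uniq_leaves_wedge.
(* Telescoping: the [J] multiplying each difference is a conditional density and does not change its
   norm. *)
have -> : norm1 (fun y => J (Join t1 t2) xi y - J (wedge_tree p (Join t1 t2)) xi y) =
   norm1 (fun y => J t2 xi y * (J t1 xi y - J S1 xi y) + J S1 xi y * (J t2 xi y - J S2 xi y)).
  by apply: eq_norm1 => y; rewrite /S1 /S2 /wedge_tree /= !(J_Join _ _ _ s); ring.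
have depD t : depends (r :: leaves t) (fun y => J t xi y - J (wedge_tree p t) xi y).
  apply: (@dependsS _ _ ((r :: leaves t) ++ (r :: leaves (wedge_tree p t)))).
    by move=> i; rewrite mem_cat [X in _ || X]inE mem_leaves_wedge -in_cons orbb.
  exact: (dependsD (depends_J (t:=t) s) (dependsN (depends_J (t:=wedge_tree p t) s))).
apply: le_trans (norm1D _ _) _; apply: lerD.
  rewrite (norm1_JM s b2 u2 _ (depD t1)) ?mem_head ?IH1 //.
  by rewrite /= negb_or r2; apply: disjointC.
rewrite (norm1_JM s bS1 uS1 _ (depD t2)) ?mem_head ?IH2 //.
apply/hasPn => i; rewrite inE [X in ~~ X]mem_leaves_wedge => /predU1P[-> //|].
by move/(hasPn d).
Qed.

End Wedge.

(** * Reshaping trees *)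

Section PairSum.
Variables (R : realType) (I : eqType).
Implicit Types (e : I -> I -> R) (A B : seq I).

(** The sum runs over ordered pairs, so each unordered pair counts twice; hence the factors 2
    below. *)
Definition pairsum e A : R := \sum_(i <- A) \sum_(j <- A) e i j.

Lemma pairsum_cons e i A : (forall j k, e j k = e k j) -> e i i = 0 ->
  pairsum e (i :: A) = pairsum e A + 2 * \sum_(k <- A) e i k.
Proof.
move=> sym ii; rewrite /pairsum big_cons big_cons ii add0r.
have -> : \sum_(j <- A) \sum_(k <- i :: A) e j k =
    \sum_(j <- A) e i j + \sum_(j <- A) \sum_(k <- A) e j k.
  by rewrite -big_split /=; apply: eq_bigr => j _; rewrite big_cons sym.
ring.
Qed.

Lemma pairsum_cat e A B : (forall j k, e j k = e k j) ->
  pairsum e (A ++ B) = pairsum e A + pairsum e B + 2 * \sum_(k <- A) \sum_(l <- B) e k l.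
Proof.
move=> sym; rewrite /pairsum big_cat /=.
rewrite (eq_bigr (fun i => \sum_(j <- A) e i j + \sum_(j <- B) e i j)); last first.
  by move=> i _; rewrite big_cat.
rewrite [X in _ + X](eq_bigr (fun i => \sum_(j <- A) e i j + \sum_(j <- B) e i j)); last first.
  by move=> i _; rewrite big_cat.
rewrite !big_split /=.
have -> : \sum_(i <- B) \sum_(j <- A) e i j = \sum_(k <- A) \sum_(l <- B) e k l.
  by rewrite exchange_big /=; apply: eq_bigr => i _; apply: eq_bigr => j _; apply: sym.
ring.
Qed.

Lemma perm_pairsum e A B : perm_eq A B -> pairsum e A = pairsum e B.
Proof.
move=> pAB; rewrite /pairsum (perm_big _ pAB) /=; apply: eq_bigr => i _.
exact: perm_big.
Qed.

Lemma eq_pairsum e e' A :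
  (forall i j, i \in A -> j \in A -> e i j = e' i j) -> pairsum e A = pairsum e' A.
Proof. by move=> ee; apply: eq_big_seq => i iA; apply: eq_big_seq => j; apply: ee. Qed.

Lemma pairsum_ge0 e A : (forall j k, 0 <= e j k) -> 0 <= pairsum e A.
Proof. by move=> e0; apply: sumr_ge0 => i _; apply: sumr_ge0. Qed.

End PairSum.

(** * Moving the root and isolating a cherry *)

Section Reshape.
Variables (R : realType) (I : finType) (W : Type).
Local Notation cube := {ffun I -> bool}.
Local Notation tree := (wtree I W).
Implicit Types (t s : tree) (v : W -> R) (y : cube) (i j k : I).

Lemma F_JoinA v t1 t2 s y : F v (Join (Join t1 t2) s) y = F v (Join t1 (Join t2 s)) y.
Proof. rewrite !F_Join !G_Join; ring. Qed.

(** This moves the root across an edge, which does not affect [F] because there the root spin is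
    averaged out. *)
Lemma F_slide v w t s y : F v (Join (Edge w t) s) y = F v (Join t (Edge w s)) y.
Proof. rewrite !F_Join !G_Edge !F_Edge; ring. Qed.

Lemma F_EmptyR v t y : F v (Join t Empty) y = F v t y.
Proof. by rewrite F_Join /F /G /= mulr1 mulr0 addr0. Qed.

Lemma F_root v i s y : F v (Join (Leaf i) s) y = J v s (sg R i) y.
Proof. by rewrite F_Join /J /F /G /= mul1r. Qed.

(** Zipper induction: [t] is the part still to be searched and [s] is all the rest as seen from the
    current root; each step down moves material from [t] to [s]. *)
Lemma reroot_context t s i : i \in leaves t ->
  exists s', [/\ perm_eq (leaves t ++ leaves s) (i :: leaves s'),
    forall v, bounded v t -> bounded v s -> bounded v s' &
    forall v y, F v (Join t s) y = F v (Join (Leaf i) s') y].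
Proof.
elim: t s => //= [j s | w t IH s | t1 IH1 t2 IH2 s].
- by rewrite inE => /eqP <-; exists s; split.
- move=> /(IH (Edge w s)) [s' [ps bs Fs]]; exists s'; split=> //.
    by move=> v /andP[vw bt] b; apply: bs => //=; rewrite vw.
  by move=> v y; rewrite F_slide Fs.
rewrite mem_cat => /orP[/(IH1 (Join t2 s)) | /(IH2 (Join t1 s))] [s' [ps bs Fs]];
  exists s'; split=> //.
- by rewrite -catA.
- by move=> v /andP[b1 b2] b; apply: bs => //=; rewrite b2.
- by move=> v y; rewrite F_JoinA Fs.
- by apply: perm_trans ps; rewrite /= catA perm_cat2r perm_catC.
- by move=> v /andP[b1 b2] b; apply: bs => //=; rewrite b1.
- move=> v y; rewrite -Fs !F_Join !G_Join; ring.
Qed.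

Lemma reroot t i : i \in leaves t ->
  exists s, [/\ perm_eq (leaves t) (i :: leaves s),
    forall v, bounded v t -> bounded v s &
    forall v y, F v t y = F v (Join (Leaf i) s) y].
Proof.
move=> /(@reroot_context _ Empty) [s [ps bs Fs]]; exists s; split.
- by move: ps; rewrite cats0.
- by move=> v b; apply: bs.
- by move=> v y; rewrite -Fs F_EmptyR.
Qed.

Lemma msg_no_leaf v t y : leaves t = [::] -> msg v t y = (1, 0).
Proof.
elim: t => //= [w t IH /IH -> /= | t1 IH1 t2 IH2]; first by rewrite mulr0.
by case: (leaves t1) IH1 => //= -> // /IH2 -> /=; rewrite !mul1r !mul0r !addr0.
Qed.

Lemma F_no_leaf v t y : leaves t = [::] -> F v t y = 1.
Proof. by move=> /(@msg_no_leaf v _ y) e; rewrite /F e. Qed.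
Lemma G_no_leaf v t y : leaves t = [::] -> G v t y = 0.
Proof. by move=> /(@msg_no_leaf v _ y) e; rewrite /G e. Qed.

(** With one leaf the tree acts as a path, along which the weights multiply to [a]. *)
Lemma msg_one_leaf v t i : bounded v t -> leaves t = [:: i] ->
  exists2 a, `|a| <= 1 & forall y, msg v t y = (1, a * sg R i y).
Proof.
elim: t => //= [j _ [->] | w t IH /andP[vw b] /(IH b) [a a1 E] | t1 IH1 t2 IH2 /andP[b1 b2]].
- by exists 1; rewrite ?normr1 // => y; rewrite mul1r.
- exists (v w * a); first by rewrite normrM mulr_ile1.
  by move=> y; rewrite E /= mulrA.
case E1: (leaves t1) => [|j [|k s]] //=.
  move=> /(IH2 b2) [a a1 E]; exists a => // y.
  by rewrite (msg_no_leaf v y E1) E /= !mul1r !mul0r !addr0.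
case=> ji E2; case: (IH1 b1 _) => [|a a1 E]; first by rewrite E1 ji.
by exists a => // y; rewrite (msg_no_leaf v y E2) E /= !mul1r !mulr0 mulr1 add0r addr0.
Qed.

(** Descend as in [reroot_context] into a branch with at least two leaves. The search ends at a
    [Join] whose branches have at most one leaf each, hence exactly one. *)
Lemma cherry_context t s : (1 < size (leaves t))%N ->
  exists i j t1 t2 s', [/\ leaves t1 = [:: i], leaves t2 = [:: j],
    perm_eq (leaves t ++ leaves s) (i :: j :: leaves s'),
    forall v, bounded v t -> bounded v s -> [/\ bounded v t1, bounded v t2 & bounded v s'] &
    forall v y, F v (Join t s) y = F v (Join t1 (Join t2 s')) y].
Proof.
elim: t s => //= [w t IH s | t1 IH1 t2 IH2 s].
  move=> /(IH (Edge w s)) [i [j [t1 [t2 [s' [l1 l2 ps bs Fs]]]]]].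
  exists i, j, t1, t2, s'; split=> //.
    by move=> v /andP[vw bt] b; apply: bs => //=; rewrite vw.
  by move=> v y; rewrite F_slide Fs.
have [sz1 _ | sz1] := ltnP 1 (size (leaves t1)).
  have [i [j [u1 [u2 [s' [l1 l2 ps bs Fs]]]]]] := IH1 (Join t2 s) sz1.
  exists i, j, u1, u2, s'; split=> //.
  - by rewrite -catA.
  - by move=> v /andP[b1 b2] b; apply: bs => //=; rewrite b2.
  - by move=> v y; rewrite F_JoinA Fs.
have [sz2 _ | sz2] := ltnP 1 (size (leaves t2)).
  have [i [j [u1 [u2 [s' [l1 l2 ps bs Fs]]]]]] := IH2 (Join t1 s) sz2.
  exists i, j, u1, u2, s'; split=> //.
  - by apply: perm_trans ps; rewrite /= catA perm_cat2r perm_catC.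
  - by move=> v /andP[b1 b2] b; apply: bs => //=; rewrite b1.
  - move=> v y; rewrite -Fs !F_Join !G_Join; ring.
rewrite size_cat => sz.
case E1: (leaves t1) sz1 sz => [|i [|//]] _ /=.
  by rewrite add0n ltnNge sz2.
case E2: (leaves t2) sz2 => [|j [|//]] _ // _.
exists i, j, t1, t2, s; split=> //.
- by move=> v /andP[].
- by move=> v y; rewrite F_JoinA.
Qed.

Lemma eq_restr (p q : pred I) t : (forall i, i \in leaves t -> p i = q i) ->
  restr p t = restr q t.
Proof.
elim: t => //= [i E | w t IH E | t1 IH1 t2 IH2 E].
- by rewrite E ?mem_head.
- by rewrite IH.
- by rewrite IH1 ?IH2 // => i Hi; rewrite E // mem_cat Hi ?orbT.
Qed.

End Reshape.

Section Scaling.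
Variable R : realType.

(** Divide by the larger absolute value; if both numbers are zero, take c = 0 and a' = b' = 1. *)
Lemma common_scale (a b : R) : `|a| <= 1 -> `|b| <= 1 ->
  exists c a' b' : R, [/\ 0 <= c <= 1, `|a'| <= 1, `|b'| <= 1, a = c * a' /\ b = c * b'
    & `|a'| = 1 \/ `|b'| = 1].
Proof.
wlog le : a b / `|b| <= `|a|.
  move=> H a1 b1; have [le|/ltW le] := leP `|b| `|a|; first exact: H.
  have [c [a' [b' [c1 a'1 b'1 [ea eb] h]]]] := H _ _ le b1 a1.
  by exists c, b', a'; split=> //; rewrite or_comm.
move=> a1 b1; have [a0|a0] := eqVneq a 0.
  exists 0, 1, 1; move: le; rewrite a0 normr0 normr_le0 => /eqP ->.
  by split; rewrite ?normr1 ?mul0r ?ler01 ?lexx //; left.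
have na : `|a| != 0 by rewrite normr_eq0.
have pa : 0 < `|a| by rewrite normr_gt0.
exists `|a|, (a / `|a|), (b / `|a|); split.
- by rewrite normr_ge0.
- by rewrite normrM normfV normr_id divff.
- by rewrite normrM normfV normr_id ler_pdivrMr // mul1r.
- by split; rewrite mulrCA divff // mulr1.
- by left; rewrite normrM normfV normr_id divff.
Qed.

Lemma norm1_sqr (a : R) : `|a| = 1 -> a * a = 1.
Proof. by move=> h; rewrite -expr2 -(real_normK (num_real a)) h expr1n. Qed.

End Scaling.

(** * Trees of the same shape *)

Section SameShape.
Variables (R : realType) (I : finType).
Local Notation cube := {ffun I -> bool}.
Implicit Types (y : {ffun I -> bool}) (i j k l : I).

Section Pendant.
Variables (W : Type) (v : W -> R) (s : wtree I W) (i j : I).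
Hypotheses (us : uniq (i :: j :: leaves s)).

(** [pendant] and [cherry] are the densities after hanging one or two leaves on the root of [s].
    Weights are real arguments here, so that both are visibly affine in each weight. *)
Definition pendant (a : R) k y := F v s y + a * (sg R k y * G v s y).

Definition cherry (a b : R) y :=
  F v s y * (1 + a * b * (sg R i y * sg R j y)) +
  G v s y * (a * sg R i y + b * sg R j y).

Definition cherry_tree (a b : W) : wtree I W :=
  Join (Edge a (Leaf i)) (Join (Edge b (Leaf j)) s).

Lemma F_pendant w k y : F v (Join (Edge w (Leaf k)) s) y = pendant (v w) k y.
Proof. by rewrite F_Join /pendant /F /G /= mul1r mulrA. Qed.

Lemma F_cherry_tree a b y : F v (cherry_tree a b) y = cherry (v a) (v b) y.
Proof. rewrite !F_Join !G_Join /cherry /F /G /=; ring. Qed.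

Lemma uniq_pendants : [/\ i != j, i \notin leaves s, j \notin leaves s & uniq (leaves s)].
Proof. by move: us; rewrite /= inE negb_or => /andP[/andP[-> ->] /andP[-> ->]]. Qed.

Lemma ga_Edge_Leaf w k : ga v (Edge w (Leaf k)) k = v w.
Proof. by rewrite ga_Edge ga_Leaf mulr1. Qed.

Lemma al_one_leaf u k l : leaves u = [:: k] -> uniq (k :: leaves s) -> l \in leaves s ->
  al v (Join u s) k l = ga v u k * ga v s l.
Proof.
move=> lu /[dup] u' /= /andP[ks _] ls; rewrite al_JoinX ?lu //=.
  by rewrite inE; apply: contraNneq ks => <-.
by apply: contraNneq ks => ->.
Qed.

Lemma al_one_leaf_rest u k l l' : leaves u = [:: k] -> uniq (k :: leaves s) ->
  l \in leaves s -> l' \in leaves s -> al v (Join u s) l l' = al v s l l'.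
Proof.
move=> lu /[dup] u' /= /andP[ks us'] ls l's; rewrite al_JoinC al_JoinL ?lu //=.
- by rewrite -cat1s uniq_catC.
- by rewrite inE; apply: contraNneq ks => <-.
- by rewrite inE; apply: contraNneq ks => <-.
Qed.

End Pendant.
Arguments al_one_leaf_rest {W} v {s u} k {l l'}.

Section TwoWeights.
Variables (W : Type) (v v' : W -> R) (s : wtree I W).

(** Since [|a| = 1], leaf [i] reveals the root spin in the first model, and [cherry] is [pendant]
    times the conditional density of [j] given [i]. Giving the second model the same factor leaves
    an error made of pair discrepancies. *)
Lemma norm1_drop i j (a b a' b' : R) : uniq (i :: j :: leaves s) -> bounded v' s ->
  `|a| = 1 -> `|b| <= 1 ->
  norm1 (fun y => cherry v s i j a b y - cherry v' s i j a' b' y) <=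
  norm1 (fun y => pendant v s a i y - pendant v' s a' i y) + `|a * b - a' * b'| +
  (\sum_(k <- leaves s) `|a * ga v s k - a' * ga v' s k| +
   \sum_(k <- leaves s) `|b * ga v s k - b' * ga v' s k|).
Proof.
move=> u bs a1 b1; have aa := norm1_sqr a1.
have [ij is_ js us] := uniq_pendants u.
pose H y := pendant v s a i y - pendant v' s a' i y.
pose X y := 1 + a * b * (sg R i y * sg R j y) : R.
have depH : depends (i :: leaves s) H.
  apply: (@dependsS _ _ ((leaves s ++ (i :: leaves s)) ++ (leaves s ++ (i :: leaves s)))).
    by move=> k; rewrite !(mem_cat, inE); case: (k \in leaves s) (k == i) => [] [].
  have dp w c : depends (leaves s ++ (i :: leaves s)) (pendant w s c i).
    apply: dependsD (@depends_F _ _ _ w s) _.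
    move=> y z eyz; congr (_ * _).
    exact: (depends_cons (i := i) (@depends_G _ _ _ w s) eyz).
  exact: (dependsD (dp v a) (dependsN (dp v' a'))).
have X0 y : 0 <= X y.
  have : `|a * b * (sg R i y * sg R j y)| <= 1 by rewrite !normrM !norm_sg a1 !mul1r mulr1.
  by rewrite ler_norml /X => /andP[? _]; lra.
(* [X] averages to 1 over the spin of [j], on which [H] does not depend. *)
have NXH : norm1 (fun y => X y * H y) = norm1 H.
  rewrite /norm1 (eq_avg (h2 := fun y => `|H y| + a * b * (sg R j y * (sg R i y * `|H y|)))).
    rewrite avgD avgZ (avg_sgM (A := i :: leaves s)) ?mulr0 ?addr0 //.
      apply: (@dependsS _ _ (i :: i :: leaves s)); last exact: depends_cons (depends_norm depH).
      by move=> k; rewrite !inE; case: eqP.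
    by rewrite inE negb_or eq_sym ij.
  by move=> y; rewrite normrM ger0_norm // /X; ring.
have E y : cherry v s i j a b y - cherry v' s i j a' b' y =
    X y * H y + ((a * b - a' * b') * (sg R i y * (sg R j y * F v' s y)) +
       (a * b * a' - b') * (sg R j y * G v' s y)).
  have ii := sg_sqr R i y; rewrite /cherry /X /H /pendant.
  move: (sg R i y) (sg R j y) (F v s y) (F v' s y) (G v s y) (G v' s y) ii => x x' f f' g g' xx.
  transitivity (X y * 0 + (f + a * x * g + a * b * (x * x') * f + (a * a) * (x * x) * b * x' * g
     - (f' * (1 + a' * b' * (x * x')) + g' * (a' * x + b' * x')))).
    by rewrite aa xx; ring.
  transitivity ((1 + a * b * (x * x')) * (f + a * (x * g) - (f' + a' * (x * g'))) +
    ((a * b - a' * b') * (x * (x' * f')) + (a * b * a' * (x * x) - b') * (x' * g'))); first by ring.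
  by rewrite xx; ring.
rewrite (eq_norm1 E); apply: le_trans (norm1D _ _) _.
rewrite NXH -!addrA lerD2l; apply: le_trans (norm1D _ _) _.
rewrite !norm1Z !norm1_sgM norm1_F // mulr1 lerD2l.
apply: le_trans (ler_wpM2l (normr_ge0 _) (norm1_G_sum bs us)) _.
rewrite -big_split mulr_sumr /=; apply: ler_sum => k _.
rewrite -normrM; set g := ga v s k; set g' := ga v' s k.
(* By a * a = 1 the coefficient splits into the discrepancies of the pairs (i, k) and (j, k). *)
have -> : (a * b * a' - b') * g' = - (a * b) * (a * g - a' * g') + (b * g - b' * g').
  by transitivity (- (a * a) * b * g + a * b * a' * g' + (b * g - b' * g')); [rewrite aa | ]; ring.
apply: le_trans (ler_normD _ _) _; rewrite lerD2r normrM normrN normrM a1 mul1r.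
exact: ler_piMl.
Qed.

Lemma cherryC i j a b y : cherry v s i j a b y = cherry v s j i b a y.
Proof. rewrite /cherry; ring. Qed.

End TwoWeights.

Definition discr W W' (v : W -> R) (v' : W' -> R) (t : wtree I W) (t' : wtree I W') i j :=
  `|al v t i j - al v' t' i j|.

Lemma discr_sym W W' (v : W -> R) (v' : W' -> R) t t' i j :
  discr v v' t t' i j = discr v v' t t' j i.
Proof. by rewrite /discr !(al_sym _ _ i j). Qed.

Lemma discr_diag W W' (v : W -> R) (v' : W' -> R) t t' i :
  uniq (leaves t) -> uniq (leaves t') -> discr v v' t t' i i = 0.
Proof. by move=> u u'; rewrite /discr !al_diag // subrr normr0. Qed.

(** Dropping [j] costs Ei + Ej on top of N + 2 Ei, and symmetrically for [i]. Keeping the leaf with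
    the smaller sum makes 3 Ei + Ej at most 2 Ei + 2 Ej. The unit weight may sit in either model
    because the norm is symmetric. *)
Lemma norm1_cherry_scaled (W : Type) (v v' : W -> R) (s : wtree I W) i j (a b a' b' : R) Ei Ej N :
  uniq (i :: j :: leaves s) -> bounded v s -> bounded v' s ->
  `|a| <= 1 -> `|b| <= 1 -> `|a'| <= 1 -> `|b'| <= 1 ->
  `|a| = 1 \/ `|a'| = 1 -> `|b| = 1 \/ `|b'| = 1 ->
  Ei = \sum_(k <- leaves s) `|a * ga v s k - a' * ga v' s k| ->
  Ej = \sum_(k <- leaves s) `|b * ga v s k - b' * ga v' s k| ->
  norm1 (fun y => pendant v s a i y - pendant v' s a' i y) <= N + 2 * Ei ->
  norm1 (fun y => pendant v s b j y - pendant v' s b' j y) <= N + 2 * Ej ->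
  norm1 (fun y => cherry v s i j a b y - cherry v' s i j a' b' y) <=
  N + 2 * Ei + 2 * Ej + 2 * `|a * b - a' * b'|.
Proof.
move=> u bs bs' a1 b1 a1' b1' ha hb EiE EjE Hi Hj.
have u' : uniq (j :: i :: leaves s).
  by rewrite (perm_uniq (s2 := [:: i, j & leaves s])) // (perm_catCA [:: j] [:: i]).
have dropi : norm1 (fun y => cherry v s i j a b y - cherry v' s i j a' b' y) <=
    norm1 (fun y => pendant v s a i y - pendant v' s a' i y) + `|a * b - a' * b'| + (Ei + Ej).
  case: ha => [a11|a11]; first by rewrite EiE EjE; apply: norm1_drop.
  rewrite (norm1_sub (cherry v s i j a b)) (norm1_sub (pendant v s a i)) distrC.
  apply: le_trans (norm1_drop v' a b u bs a11 b1') _.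
  rewrite lerD2l EiE EjE le_eqVlt; apply/orP; left; apply/eqP.
  by congr (_ + _); apply: eq_bigr => k _; rewrite distrC.
have dropj : norm1 (fun y => cherry v s i j a b y - cherry v' s i j a' b' y) <=
    norm1 (fun y => pendant v s b j y - pendant v' s b' j y) + `|a * b - a' * b'| + (Ei + Ej).
  rewrite (eq_norm1 (h2 := fun y => cherry v s j i b a y - cherry v' s j i b' a' y)); last first.
    by move=> y; rewrite (cherryC v) (cherryC v').
  rewrite (mulrC a) (mulrC a') (addrC Ei).
  case: hb => [b11|b11]; first by rewrite EiE EjE; apply: norm1_drop.
  rewrite (norm1_sub (cherry v s j i b a)) (norm1_sub (pendant v s b j)) distrC.
  apply: le_trans (norm1_drop v' b a u' bs b11 a1') _.
  rewrite lerD2l EiE EjE le_eqVlt; apply/orP; left; apply/eqP.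
  by congr (_ + _); apply: eq_bigr => k _; rewrite distrC.
have e0 := normr_ge0 (a * b - a' * b').
by have [le|/ltW le] := leP Ei Ej; [move: dropi | move: dropj]; lra.
Qed.

Lemma pairsum_pendant W (v v' : W -> R) w (s : wtree I W) i : uniq (i :: leaves s) ->
  pairsum (discr v v' (Join (Edge w (Leaf i)) s) (Join (Edge w (Leaf i)) s)) (i :: leaves s) =
  pairsum (discr v v' s s) (leaves s) +
  2 * \sum_(k <- leaves s) `|v w * ga v s k - v' w * ga v' s k|.
Proof.
move=> u; rewrite pairsum_cons.
- congr (_ + 2 * _).
    by apply: eq_pairsum => k l ks ls; rewrite /discr !(al_one_leaf_rest _ i).
  by apply: eq_big_seq => k ks; rewrite /discr !al_one_leaf // !ga_Edge_Leaf.
- exact: discr_sym.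
- exact: discr_diag.
Qed.

Lemma pairsum_cherry W (v v' : W -> R) a b (s : wtree I W) i j :
  uniq (i :: j :: leaves s) ->
  pairsum (discr v v' (cherry_tree s i j a b) (cherry_tree s i j a b)) (i :: j :: leaves s) =
  pairsum (discr v v' s s) (leaves s) +
  2 * \sum_(k <- leaves s) `|v a * ga v s k - v' a * ga v' s k| +
  2 * \sum_(k <- leaves s) `|v b * ga v s k - v' b * ga v' s k| +
  2 * `|v a * v b - v' a * v' b|.
Proof.
move=> u; have [ij is_ js us] := uniq_pendants u.
have uj : uniq (j :: leaves s) by rewrite /= js.
have jE (w : W -> R) k : k \in j :: leaves s -> 
    ga w (Join (Edge b (Leaf j)) s) k = if k == j then w b else ga w s k.
  rewrite inE; have [-> _|kj /= ks] := eqVneq k j.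
    by rewrite ga_JoinL //= ?ga_Edge_Leaf.
  by rewrite ga_JoinC ga_JoinL //= ?inE // -cat1s uniq_catC.
rewrite (@pairsum_pendant _ v v' a (Join (Edge b (Leaf j)) s) i) //=.
rewrite pairsum_pendant // big_cons !jE ?mem_head // eqxx.
have -> : \sum_(k <- leaves s) `|v a * ga v (Join (Edge b (Leaf j)) s) k -
     v' a * ga v' (Join (Edge b (Leaf j)) s) k| =
  \sum_(k <- leaves s) `|v a * ga v s k - v' a * ga v' s k|.
  apply: eq_big_seq => k ks; rewrite !jE ?inE ?ks ?orbT //.
  by rewrite (negbTE (_ : k != j)) //; apply: contraNneq js => <-.
ring.
Qed.

Theorem norm1_same_shape (t : wtree I (R * R)) : uniq (leaves t) ->
  bounded fst t -> bounded snd t ->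
  norm1 (fun y => F fst t y - F snd t y) <= pairsum (discr fst snd t t) (leaves t).
Proof.
have [n] := ubnP (size (leaves t)); elim: n t => // n IH t szt ut b1 b2.
have [sz|sz] := ltnP 1 (size (leaves t)); last first.
  rewrite (eq_norm1 (h2 := fun=> 0)); first by rewrite norm1_0 pairsum_ge0 // => *; apply: normr_ge0.
  move=> y; case E : (leaves t) sz => [|i [|//]] _; first by rewrite /= !F_no_leaf // subrr.
  have [c _ E1] := msg_one_leaf b1 E; have [d _ E2] := msg_one_leaf b2 E.
  by rewrite /= /F E1 E2 subrr.
have [i [j [t1 [t2 [s [l1 l2 ps bs Fs]]]]]] := @cherry_context R I _ t Empty sz.
rewrite /= cats0 in ps.
have [b11 b12 b1s] := bs fst b1 isT; have [b21 b22 b2s] := bs snd b2 isT.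
have us : uniq (i :: j :: leaves s) by rewrite -(perm_uniq ps).
have [ij is_ js us'] := uniq_pendants us.
have uj : uniq (j :: leaves s) by rewrite /= js.
have ui : uniq (i :: leaves s) by rewrite /= is_.
have [a a1 Ea] := msg_one_leaf b11 l1; have [a' a'1 Ea'] := msg_one_leaf b21 l1.
have [b b1' Eb] := msg_one_leaf b12 l2; have [b' b'1 Eb'] := msg_one_leaf b22 l2.
(* Each branch of the cherry has a single leaf, so in either model it amounts to one edge; pairing
   the effective weights keeps a common shape. *)
pose Q : wtree I (R * R) := cherry_tree s i j (a, a') (b, b').
have F1 y : F fst t y = F fst Q y.
  rewrite -F_EmptyR Fs !F_Join !G_Join /F /G Ea Eb /=; ring.
have F2 y : F snd t y = F snd Q y.
  rewrite -F_EmptyR Fs !F_Join !G_Join /F /G Ea' Eb' /=; ring.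
have -> : pairsum (discr fst snd t t) (leaves t) = pairsum (discr fst snd Q Q) (i :: j :: leaves s).
  rewrite (perm_pairsum _ ps); apply: eq_pairsum => k l _ _; rewrite /discr.
  by congr (`|_ - _|); apply: eq_avg => y; rewrite ?F1 ?F2.
rewrite (eq_norm1 (h2 := fun y => F fst Q y - F snd Q y)); last by move=> y; rewrite F1 F2.
rewrite pairsum_cherry //=.
rewrite (eq_norm1 (h2 := fun y => cherry fst s i j a b y - cherry snd s i j a' b' y)); last first.
  by move=> y; rewrite !F_cherry_tree.
have szs : ((size (leaves s)).+1 < n)%N by move: szt; rewrite (perm_size ps).
have IHs := IH s (ltnW szs) us' b1s b2s.
have IHp w k : `|w.1| <= 1 -> `|w.2| <= 1 -> uniq (k :: leaves s) ->
    norm1 (fun y => pendant fst s w.1 k y - pendant snd s w.2 k y) <=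
    pairsum (discr fst snd s s) (leaves s) +
    2 * \sum_(k <- leaves s) `|w.1 * ga fst s k - w.2 * ga snd s k|.
  move=> w1 w2 u; have /= := IH (Join (Edge w (Leaf k)) s) szs u.
  rewrite w1 w2 b1s b2s pairsum_pendant // => /(_ isT isT); apply: le_trans.
  by rewrite le_eqVlt; apply/orP; left; apply/eqP; apply: eq_norm1 => y; rewrite !F_pendant.
have [c [p [p' [c01 p1 p1' [-> ->] hp]]]] := common_scale a1 a'1.
have [d [q [q' [d01 q1 q1' [-> ->] hq]]]] := common_scale b1' b'1.
have Hi := IHp (p, p') i p1 p1' ui; have Hj := IHp (q, q') j q1 q1' uj.
have Hij := norm1_cherry_scaled us b1s b2s p1 q1 p1' q1' hp hq erefl erefl Hi Hj.
have sumZ (e w w' : R) : 0 <= e -> \sum_(k <- leaves s) `|e * w * ga fst s k - e * w' * ga snd s k| =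
    e * \sum_(k <- leaves s) `|w * ga fst s k - w' * ga snd s k|.
  by move=> e0; rewrite mulr_sumr; apply: eq_bigr => k _; rewrite -!mulrA -mulrBr normrM ger0_norm.
have [c0 c1] := andP c01; have [d0 d1] := andP d01.
rewrite !sumZ // (mulrACA c p) (mulrACA c p') -mulrBr [`|c * d * _|]normrM.
rewrite [`|c * d|]ger0_norm ?mulr_ge0 //.
(* Bilinear interpolation between weight 0 and the rescaled weights; a leaf of weight 0 is detached,
   which leaves [s] alone or with one pendant leaf. *)
have mixE v w w' y : cherry v s i j (c * w) (d * w') y =
   (1 - c) * (1 - d) * F v s y + c * (1 - d) * pendant v s w i y +
   (1 - c) * d * pendant v s w' j y + c * d * cherry v s i j w w' y.
  rewrite /cherry /pendant; ring.
rewrite (eq_norm1 (h2 := fun y =>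
   (1 - c) * (1 - d) * (F fst s y - F snd s y) +
   c * (1 - d) * (pendant fst s p i y - pendant snd s p' i y) +
   (1 - c) * d * (pendant fst s q j y - pendant snd s q' j y) +
   c * d * (cherry fst s i j p q y - cherry snd s i j p' q' y))); last first.
  by move=> y; rewrite !mixE; ring.
apply: le_trans (norm1D _ _) _; apply: le_trans (lerD (norm1D _ _) (lexx _)) _.
apply: le_trans (lerD (lerD (norm1D _ _) (lexx _)) (lexx _)) _; rewrite !norm1Z.
have cd00 : 0 <= (1 - c) * (1 - d) by rewrite mulr_ge0 ?subr_ge0.
have cd10 : 0 <= c * (1 - d) by rewrite mulr_ge0 ?subr_ge0.
have cd01 : 0 <= (1 - c) * d by rewrite mulr_ge0 ?subr_ge0.
have cd11 : 0 <= c * d by rewrite mulr_ge0.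
rewrite (ger0_norm cd00) (ger0_norm cd10) (ger0_norm cd01) (ger0_norm cd11).
(* The four coefficients add up to 1, those of [Hi] and [Hij] to c, those of [Hj] and [Hij] to d, so
   the combined bounds equal the right-hand side. *)
apply: le_trans (lerD (lerD (lerD (ler_wpM2l cd00 IHs) (ler_wpM2l cd10 Hi))
  (ler_wpM2l cd01 Hj)) (ler_wpM2l cd11 Hij)) _.
by rewrite le_eqVlt; apply/orP; left; apply/eqP => /=; ring.
Qed.
End SameShape.
Arguments al_one_leaf_rest {R I W} v {s u} k {l l'}.
Arguments al_one_leaf {R I W} v {s} u {k l}.

(** * Trees of arbitrary shapes *)

Section AnyShape.
Variables (R : realType) (I : finType).
Implicit Types (y : {ffun I -> bool}) (i j : I) (s t k l : wtree I R).
Local Notation v := (@idfun R).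

(** The weights of the edges stripped from the root multiply to [a]; branches without leaves have
    message (1, 0) and are skipped. *)
Lemma branching s : (1 < size (leaves s))%N -> bounded v s ->
  exists a k l, [/\ `|a| <= 1, bounded v k && bounded v l,
    leaves s = leaves k ++ leaves l,
    (0 < size (leaves k))%N && (0 < size (leaves l))%N &
    forall y, F v s y = F v (Join k l) y /\ G v s y = a * G v (Join k l) y].
Proof.
elim: s => //= [w s IH sz /andP[w1 /(IH sz)] | s1 IH1 s2 IH2 sz /andP[b1 b2]].
  move=> [a [k [l [a1 bkl lE kl E]]]]; exists (w * a), k, l; split=> //.
    by rewrite normrM mulr_ile1.
  by move=> y; rewrite F_Edge G_Edge -mulrA; have [-> ->] := E y.
have [E1|n1] := eqVneq (leaves s1) [::].
  rewrite E1 in sz *; have [a [k [l [a1 bkl lE kl E]]]] := IH2 sz b2.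
  exists a, k, l; split=> // y; rewrite [F _ (Join s1 s2) _]F_Join [G _ (Join s1 s2) _]G_Join.
  rewrite (F_no_leaf _ _ E1) (G_no_leaf _ _ E1).
  by rewrite !mul1r !mul0r !addr0; apply: E.
have [E2|n2] := eqVneq (leaves s2) [::].
  rewrite E2 cats0 in sz *; have [a [k [l [a1 bkl lE kl E]]]] := IH1 sz b1.
  exists a, k, l; split=> // y; rewrite [F _ (Join s1 s2) _]F_Join [G _ (Join s1 s2) _]G_Join.
  rewrite (F_no_leaf _ _ E2) (G_no_leaf _ _ E2).
  by rewrite !mulr1 !mulr0 addr0 add0r; apply: E.
exists 1, s1, s2; split=> //.
- by rewrite normr1.
- by rewrite b1 b2.
- by rewrite !lt0n !size_eq0 n1 n2.
- by move=> y; rewrite mul1r.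
Qed.

(** The induction hypothesis for fewer than [n] leaves; the factor 2 offsets the double counting in
    [pairsum]. *)
Definition close_below n := forall t t', (size (leaves t) < n)%N ->
  perm_eq (leaves t) (leaves t') -> uniq (leaves t) -> bounded v t -> bounded v t' ->
  2 * norm1 (fun y => F v t y - F v t' y) <=
  (size (leaves t))%:R * pairsum (discr v v t t') (leaves t).

(* Both trees are rooted at the leaf [i]. The first one factors at [i] into [k]
   and [l]; the second one is compared with its own wedge at [i] along the same
   bipartition, and each factor of that wedge with [k] or [l] by [close_below]. *)
Lemma norm1_at_root n i k l s :
  (size (leaves k) + size (leaves l) < n)%N ->
  (0 < size (leaves k))%N -> (0 < size (leaves l))%N ->
  perm_eq (leaves k ++ leaves l) (leaves s) ->
  uniq (i :: leaves s) -> bounded v k -> bounded v l -> bounded v s ->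
  close_below n ->
  2 * norm1 (fun y => J v (Join k l) (sg R i) y - J v s (sg R i) y) <=
  (size (i :: leaves s))%:R *
    pairsum (discr v v (Join (Leaf i) (Join k l)) (Join (Leaf i) s)) (i :: leaves s).
Proof.
move=> sz k0 l0 pkl us bk bl bs IH.
have /= /andP[is_ us'] := us.
have ukl : uniq (leaves k ++ leaves l) by rewrite (perm_uniq pkl).
have ikl : i \notin leaves k ++ leaves l by rewrite (perm_mem pkl).
have [ik il] : i \notin leaves k /\ i \notin leaves l.
  by move: ikl; rewrite mem_cat negb_or => /andP[].
have /and3P[uk dkl ul] : [&& uniq (leaves k), ~~ has (mem (leaves k)) (leaves l) & uniq (leaves l)].
  by rewrite -cat_uniq.
have sgi := @is_sign_sg R I i.
pose p : pred I := mem (leaves k); pose q : pred I := mem (leaves l).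
have qE : restr (predC p) s = restr q s.
  apply: eq_restr => j; rewrite -(perm_mem pkl) mem_cat /p /q /= => /orP[jk|jl].
    by rewrite jk (negbTE (uniq_catL ukl jk)).
  by rewrite jl (uniq_catR ukl jl).
have pk : perm_eq (leaves (restr p s)) (leaves k).
  rewrite leaves_restr; apply: perm_trans (perm_filter p _) _; first by rewrite perm_sym; exact: pkl.
  rewrite filter_cat (eq_in_filter (a2 := predT)) ?filter_predT // (eq_in_filter (a2 := pred0)).
    by rewrite filter_pred0 cats0.
  by move=> j jl; apply: negbTE; apply: uniq_catR ukl jl.
have pl : perm_eq (leaves (restr q s)) (leaves l).
  rewrite leaves_restr; apply: perm_trans (perm_filter q _) _; first by rewrite perm_sym; exact: pkl.
  rewrite filter_cat (eq_in_filter (a2 := pred0)); last first.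
    by move=> j jl; apply: negbTE; apply: uniq_catL ukl jl.
  by rewrite filter_pred0 (eq_in_filter (a2 := predT)) ?filter_predT.
set t := Join (Leaf i) (Join k l); set t' := Join (Leaf i) s.
pose e : I -> I -> R := discr v v t t'.
have eS : forall a b, e a b = e b a by move=> a b; apply: discr_sym.
have ut : uniq (leaves t) by rewrite /= ikl.
have ut' : uniq (leaves t') by rewrite /= is_.
have eii : e i i = 0 by rewrite /e discr_diag.
rewrite (perm_pairsum _ (_ : perm_eq _ (i :: leaves k ++ leaves l))); last by rewrite perm_cons perm_sym.
rewrite pairsum_cons // pairsum_cat // big_cat /=.
have e_ge0 a b : 0 <= e a b by apply: normr_ge0.
have ukl' : uniq (i :: leaves (Join k l)) by rewrite /= ikl.
have memP a : (a \in leaves s) = (a \in leaves (Join k l)) by rewrite (perm_mem pkl).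
have e_rest a b : a \in leaves s -> b \in leaves s ->
    e a b = `|al v (Join k l) a b - al v s a b|.
  by move=> as_ bs_; rewrite /e /discr !(al_one_leaf_rest (u := Leaf i) _ i) -?memP.
have e_root a : a \in leaves s -> e i a = `|ga v (Join k l) a - ga v s a|.
  by move=> as_; rewrite /e /discr !(al_one_leaf _ (Leaf i)) -?memP // !ga_Leaf !mul1r.
have gak a : a \in leaves k -> ga v (Join k l) a = ga v k a.
  by move=> ak; rewrite ga_JoinL // (uniq_catL ukl ak).
have gal a : a \in leaves l -> ga v (Join k l) a = ga v l a.
  by move=> al_; rewrite ga_JoinC ga_JoinL // ?(uniq_catR ukl al_) // uniq_catC.
(* The induction hypothesis for one factor with leaf [i] put back at its root. It will be small
   enough because the other factor has at least one leaf. *)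
have side u (r : pred I) : uniq (i :: leaves u) -> {subset leaves u <= leaves k ++ leaves l} ->
    perm_eq (leaves (restr r s)) (leaves u) -> bounded v u ->
    (forall a, a \in leaves u -> ga v (Join k l) a = ga v u a) ->
    (forall a b, a \in leaves u -> b \in leaves u -> al v (Join k l) a b = al v u a b) ->
    (size (i :: leaves u) < n)%N ->
    2 * norm1 (fun y => J v u (sg R i) y - J v (restr r s) (sg R i) y) <=
    (1 + (size (leaves u))%:R) * (pairsum e (leaves u) + 2 * \sum_(a <- leaves u) e i a).
  move=> uu sub pu bu gu au szu.
  have mem_r a : a \in leaves u -> (a \in leaves (restr r s)) /\ (a \in leaves s /\ r a).
    move=> /[dup] a_u; rewrite -(perm_mem pu) => a_r; split=> //; move: a_r.
    by rewrite leaves_restr mem_filter => /andP[].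
  have ur : uniq (i :: leaves (restr r s)) by rewrite /= (perm_mem pu) (perm_uniq pu).
  have := IH (Join (Leaf i) u) (Join (Leaf i) (restr r s)) szu.
  rewrite [leaves _]/= perm_cons perm_sym pu => /(_ isT uu bu (bounded_restr r bs)).
  rewrite (eq_norm1 (h2 := fun y => J v u (sg R i) y - J v (restr r s) (sg R i) y)); last first.
    by move=> y; rewrite !F_root.
  rewrite pairsum_cons; last 2 first.
  - by move=> *; apply: discr_sym.
  - by rewrite discr_diag.
  rewrite (_ : pairsum (discr v v (Join (Leaf i) u) (Join (Leaf i) (restr r s))) (leaves u) =
     pairsum e (leaves u)); last first.
    apply: eq_pairsum => a b a_u b_u; have [ar [as_ ra]] := mem_r a a_u; have [br [bs_ rb]] := mem_r b b_u.
    by rewrite e_rest // /discr !(al_one_leaf_rest (u := Leaf i) _ i) ?au ?al_restr.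
  congr (_ <= _ * (_ + 2 * _)); first by rewrite /= -natr1 addrC.
  apply: eq_big_seq => a a_u; have [ar [as_ ra]] := mem_r a a_u.
  by rewrite e_root // /discr !(al_one_leaf _ (Leaf i)) // !ga_Leaf !mul1r gu // ga_restr.
have sk : {subset leaves k <= leaves k ++ leaves l} by move=> a; rewrite mem_cat => ->.
have sl : {subset leaves l <= leaves k ++ leaves l} by move=> a; rewrite mem_cat orbC => ->.
have szk : (size (i :: leaves k) < n)%N by apply: leq_ltn_trans sz; rewrite /= -addn1 leq_add2l.
have szl : (size (i :: leaves l) < n)%N by apply: leq_ltn_trans sz; rewrite /= -add1n leq_add2r.
have uik : uniq (i :: leaves k) by rewrite /= ik.
have uil : uniq (i :: leaves l) by rewrite /= il.
have alk a b : a \in leaves k -> b \in leaves k -> al v (Join k l) a b = al v k a b.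
  by move=> ak bk'; rewrite al_JoinL // (uniq_catL ukl).
have all a b : a \in leaves l -> b \in leaves l -> al v (Join k l) a b = al v l a b.
  by move=> ak bk'; rewrite al_JoinC al_JoinL 1?uniq_catC // (uniq_catR ukl).
have Hk := side k p uik sk pk bk gak alk szk.
have Hl := side l q uil sl pl bl gal all szl.
set SK := pairsum e (leaves k) in Hk *; set SL := pairsum e (leaves l) in Hl *.
set TK := \sum_(a <- leaves k) e i a in Hk *; set TL := \sum_(a <- leaves l) e i a in Hl *.
set X := \sum_(a <- leaves k) \sum_(b <- leaves l) e a b.
have wedge_le : norm1 (fun y => J v s (sg R i) y - J v (wedge_tree p s) (sg R i) y) <=
    X + (size (leaves l))%:R * TK + (size (leaves k))%:R * TL.
  apply: le_trans (wedge p bs us' sgi is_) _; rewrite /excess.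
  rewrite -big_filter -leaves_restr (perm_big _ pk) /=.
  have -> : X + (size (leaves l))%:R * TK + (size (leaves k))%:R * TL =
     \sum_(a <- leaves k) \sum_(b <- leaves l) (e a b + e i a + e i b).
    rewrite /X /TK /TL; under [RHS]eq_bigr do rewrite !big_split /=.
    rewrite !big_split /=; congr (_ + _ + _).
      rewrite mulr_sumr; apply: eq_bigr => a _.
      by rewrite big_const_seq count_predT iter_addr_0 mulr_natl.
    by rewrite big_const_seq count_predT iter_addr_0 mulr_natl.
  rewrite !big_seq; apply: ler_sum => a ak.
  rewrite -big_filter -[filter _ _]/(filter (predC p) (leaves s)) -leaves_restr qE (perm_big _ pl) /=.
  rewrite !big_seq; apply: ler_sum => b bl'.
  have as_ : a \in leaves s by rewrite memP sk.
  have bs_ : b \in leaves s by rewrite memP sl.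
  have := ga_le1 a bk uk; have := ga_le1 b bs us'.
  rewrite e_rest // !e_root //.
  rewrite gak // gal // al_JoinX ?(uniq_catL ukl ak) ?(uniq_catR ukl bl') ?(uniq_cat_neq ukl ak bl') //.
  move: (ga v k a) (ga v l b) (ga v s a) (ga v s b) (al v s a b) => x z x' z' c z'1 x1.
  (* In the first model the correlation is x * z. The covariance c - x' * z' of the second is thus
     controlled by the discrepancies of the pairs (a, b), (i, a) and (i, b). *)
  have h1 : `|c| - `|x'| * `|z'| <= `|c - x' * z'| by rewrite -normrM lerB_dist.
  have h2 : `|c - x' * z'| <= `|x * z - c| + `|x * z - x' * z'|.
    by rewrite (distrC (x * z)); apply: ler_distD.
  have h3 : `|x * z - x' * z'| <= `|x - x'| + `|z - z'|.
    have -> : x * z - x' * z' = (x - x') * z' + x * (z - z') by ring.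
    by apply: le_trans (ler_normD _ _) _; rewrite !normrM; apply: lerD; [apply: ler_piMr | apply: ler_piMl].
  by move: h1 h2 h3; lra.
pose k' := restr p s; pose l' := restr q s.
have uk' : uniq (leaves k') by rewrite (perm_uniq pk).
have ul' : uniq (leaves l') by rewrite (perm_uniq pl).
have split_le : norm1 (fun y => J v (Join k l) (sg R i) y - J v (wedge_tree p s) (sg R i) y) <=
    norm1 (fun y => J v k (sg R i) y - J v k' (sg R i) y) +
    norm1 (fun y => J v l (sg R i) y - J v l' (sg R i) y).
  rewrite (eq_norm1 (h2 := fun y =>
     J v l (sg R i) y * (J v k (sg R i) y - J v k' (sg R i) y) +
     J v k' (sg R i) y * (J v l (sg R i) y - J v l' (sg R i) y))); last first.
    by move=> y; rewrite /wedge_tree qE !(J_Join _ _ _ _ sgi) -/k' -/l'; ring.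
  have dep u u' : perm_eq (leaves u') (leaves u) ->
      depends (i :: leaves u) (fun y => J v u (sg R i) y - J v u' (sg R i) y).
    move=> pu; apply: (@dependsS _ _ ((i :: leaves u) ++ (i :: leaves u'))).
      by move=> a; rewrite mem_cat !inE (perm_mem pu) orbb.
    exact: (dependsD (depends_J v (t := u) sgi) (dependsN (depends_J v (t := u') sgi))).
  apply: le_trans (norm1D _ _) _.
  rewrite (norm1_JM sgi bl ul _ (dep k k' pk)) ?mem_head //; last first.
    by rewrite /= negb_or il; apply: disjointC.
  rewrite (norm1_JM sgi (bounded_restr p bs) uk' _ (dep l l' pl)) ?mem_head //.
  apply/hasPn => a; rewrite inE [X in ~~ X](perm_mem pk) => /predU1P[-> //|].
  exact: (hasPn dkl).
have := norm1_triangle (J v (Join k l) (sg R i)) (J v (wedge_tree p s) (sg R i)) (J v s (sg R i)).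
rewrite [X in _ + X]norm1_sub.
have sizeE : (size (i :: leaves s))%:R = 1 + (size (leaves k))%:R + (size (leaves l))%:R :> R.
  by rewrite /= -(perm_size pkl) size_cat -natr1 natrD; ring.
move=> tri; rewrite sizeE.
(* Adding the bounds, [TK] and [TL] get the coefficient 2 (1 + |k| + |l|) exactly as in the goal;
   the remaining slack is nonnegative by the facts that follow. *)
have SK0 : 0 <= SK by apply: pairsum_ge0.
have SL0 : 0 <= SL by apply: pairsum_ge0.
have X0 : 0 <= X by apply: sumr_ge0 => a _; apply: sumr_ge0.
have P1 : 0 <= (size (leaves l))%:R * SK by rewrite mulr_ge0.
have P2 : 0 <= (size (leaves k))%:R * SL by rewrite mulr_ge0.
have P3 : 0 <= (size (leaves k))%:R * X by rewrite mulr_ge0.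
have P4 : 0 <= (size (leaves l))%:R * X by rewrite mulr_ge0.
move: Hk Hl wedge_le split_le tri; rewrite -/k' -/l'; lra.
Qed.

Definition via_edge (a : R) i s y := F v s y + sg R i y * (a * G v s y).

(** A weight 1 or -1 above a join can be pushed into both branches: [F] is unchanged because a * a =
    1, and [G] acquires one factor a. Then [norm1_at_root] applies. *)
Lemma norm1_unit_edge n i (a a' : R) k l s :
  (size (leaves k) + size (leaves l) < n)%N ->
  (0 < size (leaves k))%N -> (0 < size (leaves l))%N ->
  perm_eq (leaves k ++ leaves l) (leaves s) ->
  uniq (i :: leaves s) -> bounded v k -> bounded v l -> bounded v s ->
  close_below n -> `|a| = 1 -> `|a'| <= 1 ->
  2 * norm1 (fun y => via_edge a i (Join k l) y - via_edge a' i s y) <=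
  (size (leaves s)).+1%:R * (pairsum (discr v v (Join k l) s) (leaves s) +
    2 * \sum_(j <- leaves s) `|a * ga v (Join k l) j - a' * ga v s j|).
Proof.
move=> sz k0 l0 pkl us bk bl bs IH a1 a'1.
pose k1 := Edge a k; pose l1 := Edge a l; pose s1 := Edge a' s.
have us1 : uniq (i :: leaves (Join k1 l1)) by rewrite /= (perm_mem pkl) (perm_uniq pkl).
have bk1 : bounded v k1 by rewrite /= a1 lexx.
have bl1 : bounded v l1 by rewrite /= a1 lexx.
have bs1 : bounded v s1 by rewrite /= a'1.
have F1 y : F v (Join k1 l1) y = F v (Join k l) y.
  rewrite !F_Join !G_Edge !F_Edge -[G v k y * _]mul1r -(norm1_sqr a1) /=; ring.
have G1 y : G v (Join k1 l1) y = a * G v (Join k l) y.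
  rewrite !G_Join !G_Edge !F_Edge /=; ring.
have := @norm1_at_root n i k1 l1 s1 sz k0 l0 pkl us bk1 bl1 bs1 IH.
rewrite (eq_norm1 (h2 := fun y => via_edge a i (Join k l) y - via_edge a' i s y)); last first.
  by move=> y; rewrite /J F1 G1.
rewrite pairsum_cons; last 2 first.
- by move=> *; apply: discr_sym.
- by rewrite discr_diag.
rewrite (_ : pairsum _ (leaves s1) = pairsum (discr v v (Join k l) s) (leaves s)); last first.
  apply: eq_pairsum => b c b_s c_s; rewrite /discr.
  rewrite !(al_one_leaf_rest (u := Leaf i) _ i) ?(perm_mem pkl) //.
  by congr (`|_ - _|); apply: eq_avg => y; rewrite F1.
congr (_ <= _ * (_ + 2 * _)); apply: eq_big_seq => b b_s.
rewrite /discr !(al_one_leaf _ (Leaf i)) ?(perm_mem pkl) // !ga_Leaf !mul1r ga_Edge.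
congr (`|_ - _|); rewrite -avgZ; apply: eq_avg => y; rewrite G1; ring.
Qed.

Theorem norm1_any_shape n : close_below n.
Proof.
elim: n => // n IH t t' szt ptt' ut bt bt'.
case E : (leaves t) => [|i A].
  have E' : leaves t' = [::] by apply: perm_nilP; rewrite perm_sym -E.
  rewrite mul0r (eq_norm1 (h2 := fun=> 0)) ?norm1_0 ?mulr0 // => y.
  by rewrite (F_no_leaf _ _ E) (F_no_leaf _ _ E') subrr.
have it : i \in leaves t by rewrite E mem_head.
have it' : i \in leaves t' by rewrite -(perm_mem ptt').
have [s [ps bs Fs]] := @reroot R _ _ t i it; have [s' [ps' bs' Fs']] := @reroot R _ _ t' i it'.
rewrite -E.
have {}bs := bs v bt; have {}bs' := bs' v bt'.
have pss' : perm_eq (leaves s) (leaves s').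
  by rewrite -(perm_cons i) -(permPl ps) -(permPr ps').
have us : uniq (i :: leaves s) by rewrite -(perm_uniq ps).
have us' : uniq (i :: leaves s') by rewrite -(perm_uniq ps') -(perm_uniq ptt').
rewrite (perm_size ps) (perm_pairsum _ ps) pairsum_cons; last 2 first.
- by move=> *; apply: discr_sym.
- by rewrite discr_diag // -(perm_uniq ptt').
rewrite (_ : pairsum (discr v v t t') (leaves s) = pairsum (discr v v s s') (leaves s)); last first.
  apply: eq_pairsum => a b as_ bs_; rewrite /discr.
  rewrite -(al_one_leaf_rest (u := Leaf i) v i erefl us) //.
  rewrite -(al_one_leaf_rest (u := Leaf i) v i erefl us') -?(perm_mem pss') //.
  by congr (`|_ - _|); apply: eq_avg => y; rewrite ?Fs ?Fs'.
rewrite (_ : \sum_(k <- leaves s) discr v v t t' i k = \sum_(k <- leaves s) `|ga v s k - ga v s' k|); last first.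
  apply: eq_big_seq => a as_; rewrite /discr.
  rewrite -[ga v s a]mul1r -[ga v s' a]mul1r -(ga_Leaf v i).
  rewrite -(al_one_leaf v (Leaf i) erefl us) // -(al_one_leaf v (Leaf i) erefl us') -?(perm_mem pss') //.
  by congr (`|_ - _|); apply: eq_avg => y; rewrite ?Fs ?Fs'.
rewrite (eq_norm1 (h2 := fun y => J v s (sg R i) y - J v s' (sg R i) y)); last first.
  by move=> y; rewrite Fs Fs' !F_root.
have szs : (size (leaves s) < n)%N by move: szt; rewrite (perm_size ps).
have psum0 (w w' : wtree I R) A' : 0 <= pairsum (discr v v w w') A' by apply: pairsum_ge0 => *; apply: normr_ge0.
(* With at most one leaf besides [i] there is nothing to factor: the norm is zero or the discrepancy
   of a single pair. *)
have [sz|sz] := ltnP 1 (size (leaves s)); last first.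
  case Es : (leaves s) sz => [|j [|//]] _.
    have Es' : leaves s' = [::] by apply: perm_nilP; rewrite perm_sym -Es.
    rewrite (eq_norm1 (h2 := fun=> 0)); last first.
      by move=> y; rewrite /J !(F_no_leaf _ _ Es) !(F_no_leaf _ _ Es') !(G_no_leaf _ _ Es) !(G_no_leaf _ _ Es') subrr.
    by rewrite norm1_0 mulr0 mulr_ge0 // addr_ge0 ?psum0 // big_nil mulr0.
  have Es' : leaves s' = [:: j] by apply: perm_small_eq => //; rewrite perm_sym -Es.
  have [a _ M] := msg_one_leaf bs Es; have [a' _ M'] := msg_one_leaf bs' Es'.
  have gaE w b : (forall y, msg v w y = (1, b * sg R j y)) -> ga v w j = b.
    move=> Mw; rewrite /ga (eq_avg (h2 := fun=> b)) ?avg_const // => y.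
    by rewrite /G Mw /= -mulrA sg_sqr mulr1.
  rewrite (eq_norm1 (h2 := fun y => (a - a') * (sg R i y * (sg R j y * 1)))); last first.
    by move=> y; rewrite /J /F /G M M' /=; ring.
  rewrite norm1Z !norm1_sgM /norm1 normr1 avg_const mulr1 big_seq1 (gaE _ _ M) (gaE _ _ M') /=.
  have := psum0 s s' [:: j]; have := normr_ge0 (a - a'); lra.
have sz' : (1 < size (leaves s'))%N by rewrite -(perm_size pss').
have [a [k [l [a1 /andP[bk bl] skl /andP[k0 l0] FG]]]] := branching sz bs.
have [a' [k' [l' [a1' /andP[bk' bl'] skl' /andP[k0' l0'] FG']]]] := branching sz' bs'.
set u := Join k l in FG; set u' := Join k' l' in FG'.
have puu' : perm_eq (leaves u) (leaves u') by rewrite /= -skl -skl'.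
have uu : uniq (i :: leaves u) by rewrite /= -skl.
have uu' : uniq (i :: leaves u') by rewrite /= -skl'.
have bu : bounded v u by rewrite /= bk.
have bu' : bounded v u' by rewrite /= bk'.
have szu : size (leaves u) = size (leaves s) by rewrite skl.
have szu' : size (leaves u') = size (leaves s) by rewrite -(perm_size puu') szu.
have [c [p [p' [/andP[c0 c1] p1 p1' [aE aE'] hp]]]] := common_scale a1 a1'.
have -> : pairsum (discr v v s s') (leaves s) = pairsum (discr v v u u') (leaves u).
  rewrite skl; apply: eq_pairsum => x z _ _; rewrite /discr; congr (`|_ - _|); apply: eq_avg => y.
    by rewrite (FG y).1.
  by rewrite (FG' y).1.
have -> : \sum_(x <- leaves s) `|ga v s x - ga v s' x| =
    c * \sum_(x <- leaves u) `|p * ga v u x - p' * ga v u' x|.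
  rewrite skl mulr_sumr; apply: eq_bigr => x _.
  have -> : ga v s x = c * p * ga v u x.
    by rewrite -aE /ga -avgZ; apply: eq_avg => y; rewrite mulrA (FG y).2.
  have -> : ga v s' x = c * p' * ga v u' x.
    by rewrite -aE' /ga -avgZ; apply: eq_avg => y; rewrite mulrA (FG' y).2.
  by rewrite -!mulrA -mulrBr normrM (ger0_norm c0).
have := IH u u'; rewrite szu => /(_ szs puu' (proj2 (andP uu)) bu bu') Hu.
have Hp : 2 * norm1 (fun y => via_edge p i u y - via_edge p' i u' y) <=
   (size (leaves s)).+1%:R * (pairsum (discr v v u u') (leaves u) +
    2 * \sum_(j <- leaves u) `|p * ga v u j - p' * ga v u' j|).
  case: hp => hp.
    rewrite (perm_pairsum _ puu') (perm_big _ puu') -szu'.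
    by apply: norm1_unit_edge IH hp p1' => //; rewrite -size_cat -skl.
  rewrite norm1_sub (_ : pairsum _ _ = pairsum (discr v v u' u) (leaves u)); last first.
    by apply: eq_pairsum => x z _ _; rewrite /discr distrC.
  rewrite (eq_bigr (fun j => `|p' * ga v u' j - p * ga v u j|)); last by move=> *; rewrite distrC.
  rewrite -szu; apply: norm1_unit_edge IH hp p1 => //; last by rewrite perm_sym.
  by rewrite -size_cat -skl' -(perm_size pss').
(* Interpolation between weight 0, where [i] is detached and the induction hypothesis compares [u]
   with [u'], and the rescaled weights. *)
rewrite (eq_norm1 (h2 := fun y => (1 - c) * (F v u y - F v u' y) +
    c * (via_edge p i u y - via_edge p' i u' y))); last first.
  move=> y; rewrite /J /via_edge (FG y).1 (FG y).2 (FG' y).1 (FG' y).2 aE aE'; ring.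
apply: le_trans (ler_wpM2l _ (norm1D _ _)) _ => //.
rewrite !norm1Z !ger0_norm ?subr_ge0 //.
have c10 : 0 <= 1 - c by rewrite subr_ge0.
have := ler_wpM2l c10 Hu; have := ler_wpM2l c0 Hp.
rewrite /= -(natr1 (size (leaves s))).
set m := _%:R; set P := pairsum _ _; set T := \sum_(j <- _) _.
have m0 : 0 <= m by apply: ler0n.
have P0 : 0 <= P by apply: psum0.
have T0 : 0 <= T by apply: sumr_ge0.
have := mulr_ge0 c10 P0; lra.
Qed.
End AnyShape.

(** * Eliminating the vertices of a graph *)

Section Elimination.
Variables (T : finType) (e : rel T).
Implicit Types (s : seq T) (u p : T).

(** Each vertex but the last has degree one in the graph induced on it and its successors, so the
    vertices can be summed out in this order. *)
Fixpoint elim_order s : bool :=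
  if s is u :: s' then
    [&& u \notin s', (s' == [::]) || (count (e u) s' == 1%N) & elim_order s']
  else true.

(** The weaker property that connectedness yields directly: at least one later neighbour. *)
Fixpoint grown s : bool :=
  if s is u :: s' then
    [&& u \notin s', (s' == [::]) || has (e u) s' & grown s']
  else true.

Lemma elim_uniq s : elim_order s -> uniq s.
Proof. by elim: s => //= u s IH /and3P[-> _ /IH]. Qed.

Lemma grown_uniq s : grown s -> uniq s.
Proof. by elim: s => //= u s IH /and3P[-> _ /IH]. Qed.

Lemma grow (k : nat) : symmetric e -> (forall u v, connect e u v) ->
  (k <= #|T|)%N -> exists2 s, size s = k & grown s.
Proof.
move=> sym conn; elim: k => [|k IH] kT; first by exists [::].
have [s sz gs] := IH (ltnW kT).
have [E|/hasPn sN] := boolP (has (fun u => (u \notin s) && ((s == [::]) || has (e u) s)) (enum T)).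
  by case/hasP: E => u _ /andP[us h]; exists (u :: s); rewrite /= ?sz ?us ?h.
have out u : u \notin s -> s != [::] /\ ~~ has (e u) s.
  move=> us; have := sN u; rewrite mem_enum us /= negb_or => /(_ isT) /andP[]; by split.
have [u us] : exists u, u \notin s.
  apply/existsP; rewrite -negb_forall; apply: contraL kT => /forallP all_s.
  rewrite -leqNgt -sz -(card_uniqP (grown_uniq gs)).
  by apply: subset_leq_card; apply/subsetP => x _; apply: all_s.
have [s0 _] := out u us.
case: s s0 {sz IH} gs sN out us => // a s _ gs sN out us.
(* If no outside vertex is adjacent to the list, the list is closed under adjacency and
   connectedness puts [u] into it. *)
have cl : closed e (mem (a :: s)).
  move=> x y exy; apply/idP/idP => [xs|ys]; apply: contraT => /out [_ /hasPn h].
    by have := h x xs; rewrite sym exy.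
  by have := h y ys; rewrite exy.
have := closed_connect cl (conn a u); rewrite /= mem_head => h.
by rewrite -h in us.
Qed.

Definition arcs s : nat := (\sum_(a <- s) \sum_(b <- s) e a b)%N.

Lemma countE u s : count (e u) s = (\sum_(b <- s) e u b)%N.
Proof. by rewrite -sum1_count big_mkcond; apply: eq_bigr => b _; case: (e u b). Qed.

Lemma arcs_cons u s : symmetric e -> irreflexive e ->
  arcs (u :: s) = (arcs s + 2 * count (e u) s)%N.
Proof.
move=> sym irr; have E : (\sum_(a <- s) \sum_(b <- u :: s) e a b = count (e u) s + arcs s)%N.
  by rewrite countE -big_split; apply: eq_bigr => a _; rewrite big_cons sym.
by rewrite {1}/arcs big_cons E big_cons irr -countE; lia.
Qed.

(** Every vertex prepended to a nonempty list adds at least one edge, that is two arcs. The arc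
    count of a tree therefore forces exactly one later neighbour each time. *)
Lemma grown_elim s : symmetric e -> irreflexive e -> grown s ->
  (2 * (size s).-1 <= arcs s)%N /\ ((arcs s <= 2 * (size s).-1)%N -> elim_order s).
Proof.
move=> sym irr; elim: s => [|u s IH] /=; first by rewrite /arcs big_nil.
case/and3P=> us h /IH [lb up]; rewrite arcs_cons //.
have [s0|s0] := eqVneq s [::]; first by rewrite us s0.
have c0 : (0 < count (e u) s)%N by rewrite -has_count; move: h; rewrite (negbTE s0).
have sz : (0 < size s)%N by rewrite lt0n size_eq0.
split; first by lia.
move=> le; have c1 : count (e u) s = 1%N by lia.
by rewrite us c1 /= up //; lia.
Qed.

Lemma tree_elim : is_tree e -> exists s, perm_eq s (enum T) /\ elim_order s.
Proof.
case=> sym [irr [conn card]].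
have [s sz gs] := grow sym conn (leqnn #|T|).
have ps : perm_eq s (enum T).
  have us := grown_uniq gs; apply: uniq_perm (enum_uniq T) _ => //.
  have sub : {subset s <= enum T} by move=> x; rewrite mem_enum.
  by have [] := uniq_min_size us sub; rewrite -?cardE ?sz.
exists s; split=> //; have [_] := grown_elim sym irr gs; apply.
rewrite sz /arcs (perm_big _ ps) /=.
under eq_bigr do rewrite (perm_big _ ps) /=.
rewrite !big_enum /=; under eq_bigr do rewrite big_enum /=.
rewrite (pair_bigA _ (fun a b => nat_of_bool (e a b))) /= -subn1 -card cardsE -sum1_card.
rewrite [X in (_ <= X)%N]big_mkcond leq_eqVlt; apply/orP; left; apply/eqP.
by apply: eq_bigr => -[a b] _; rewrite unfold_in /=; case: (e a b).
Qed.

Section EdgeProduct.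
Variables (R : comRingType) (phi : T -> T -> R).

(** A product over edges, each taken at the endpoint that comes first in the list, which suits
    elimination. *)
Fixpoint list_prod s : R :=
  if s is u :: s' then (\prod_(b <- s' | e u b) phi u b) * list_prod s' else 1.

End EdgeProduct.
End Elimination.

Lemma list_prodE (N : nat) (e : rel 'I_N) (R : comRingType) (phi : 'I_N -> 'I_N -> R) s :
  symmetric e -> irreflexive e -> (forall a b, phi a b = phi b a) ->
  list_prod e phi s = \prod_(a <- s) \prod_(b <- s | (a < b)%N && e a b) phi a b.
Proof.
move=> sym irr psym; elim: s => [|u s IH] /=; first by rewrite big_nil.
rewrite IH !big_cons ltnn /=.
have -> : \prod_(a <- s) \prod_(b <- u :: s | (a < b)%N && e a b) phi a b =
   (\prod_(a <- s | (a < u)%N && e u a) phi u a) *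
   \prod_(a <- s) \prod_(b <- s | (a < b)%N && e a b) phi a b.
  rewrite [X in X * _]big_mkcond -big_split /=; apply: eq_bigr => a _.
  by rewrite big_cons (sym u) (psym u); case: ifP; rewrite // mul1r.
rewrite mulrA; congr (_ * _).
rewrite (bigID (fun b : 'I_N => (u < b)%N)) /=; congr (_ * _); apply: eq_bigl => b.
  by rewrite andbC.
rewrite andbC -leqNgt leq_eqVlt; case: eqP => [E|//] /=.
by rewrite (_ : b = u) ?irr ?andbF //; apply: val_inj.
Qed.

(** * From an elimination order to a weighted tree *)

Section Merge.
Variables (T : finType) (I : finType) (e : rel T).
Implicit Types (s : seq T) (g : T -> wtree I (T * T)).

(** [g u] is the tree collected so far at vertex [u]. Eliminating [u] hangs it on the only later
    neighbour, through an edge named by its endpoints so that weights can be chosen afterwards. *)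
Fixpoint merge_tree s g : wtree I (T * T) :=
  if s is u :: s' then
    if [seq b <- s' | e u b] is p :: _ then
      merge_tree s' (fun x => if x == p then Join (g p) (Edge (u, p) (g u)) else g x)
    else g u
  else Empty.

Lemma count1_filter u s : count (e u) s = 1%N -> 
  exists2 p, [seq b <- s | e u b] = [:: p] & p \in s.
Proof.
rewrite -size_filter; case E: [seq b <- s | e u b] => [|p [|//]] // _.
exists p => //; have : p \in [seq b <- s | e u b] by rewrite E mem_head.
by rewrite mem_filter => /andP[].
Qed.

Lemma leaves_merge s g : elim_order e s ->
  perm_eq (leaves (merge_tree s g)) (flatten [seq leaves (g u) | u <- s]).
Proof.
elim: s g => //= u s IH g /and3P[us h es].
have [->|s0] /= := eqVneq s [::]; first by rewrite cats0.
move: h; rewrite (negbTE s0) /= => /eqP /count1_filter [p -> ps].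
apply: perm_trans (IH _ es) _.
have usn := elim_uniq es.
have pg (h : T -> wtree I (T * T)) : perm_eq (flatten [seq leaves (h x) | x <- s])
    (leaves (h p) ++ flatten [seq leaves (h x) | x <- rem p s]).
  exact: (perm_flatten (perm_map (fun x => leaves (h x)) (perm_to_rem ps))).
apply: perm_trans (pg _) _; rewrite eqxx /=.
rewrite (_ : [seq _ | x <- rem p s] = [seq leaves (g x) | x <- rem p s]); last first.
  by apply/eq_in_map => x; rewrite mem_rem_uniq // inE => /andP[/negbTE ->].
apply: (@perm_trans _ (leaves (g u) ++ leaves (g p) ++ flatten [seq leaves (g x) | x <- rem p s])).
  by rewrite catA perm_cat2r perm_catC.
by rewrite perm_cat2l perm_sym pg.
Qed.

End Merge.

Section MergeValue.
Variables (R : realType) (T : finType) (I : finType) (N : nat).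
Variables (e : rel T) (e' : rel 'I_N) (f : T -> 'I_N) (w : 'I_N -> 'I_N -> R).
Hypotheses (f_inj : injective f) (eE : forall a b, e' (f a) (f b) = e a b).
Variable (y : {ffun I -> bool}).
Implicit Types (s : seq T) (g : T -> wtree I (T * T)) (x : {ffun 'I_N -> bool}).

(** The merged tree is built from [e], the weights belong to [e']; reading them through [f] lets
    isomorphic models share one tree. *)
Definition edge_weight (p : T * T) : R := w (f p.1) (f p.2).

Definition edge_factor x (a b : 'I_N) : R := 1 + w a b * (sg R a x * sg R b x).

Definition gadget g u x : R :=
  F edge_weight (g u) y + sg R (f u) x * G edge_weight (g u) y.

Lemma depends_list_prod s :
  depends (map f s) (fun x => list_prod e' (edge_factor x) (map f s)).
Proof.
elim: s => //= u s IH x z exz; congr (_ * _).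
  rewrite [LHS]big_seq_cond [RHS]big_seq_cond.
  apply: eq_bigr => b /andP[bs _]; rewrite /edge_factor /sg.
  by rewrite !exz ?inE ?eqxx // bs orbT.
by apply: IH => i Hi; apply: exz; rewrite inE Hi orbT.
Qed.

(** Sum-product elimination: averaging over the spin of the first vertex turns its edge factor and
    its message into a branch at its neighbour. *)
Lemma avg_merge s g : elim_order e s ->
  avg (fun x => list_prod e' (edge_factor x) (map f s) * \prod_(u <- s) gadget g u x) =
  F edge_weight (merge_tree e s g) y.
Proof.
elim: s g => [|u s IH] g /=.
  by move=> _; rewrite (eq_avg (h2 := fun=> 1)) ?avg_const // => x; rewrite big_nil mulr1.
case/and3P=> us h es; have usn := elim_uniq es.
have fus : f u \notin map f s by rewrite mem_map.
have [E|s0] := eqVneq s [::].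
  rewrite E /= (eq_avg (h2 := fun x => F edge_weight (g u) y + sg R (f u) x * G edge_weight (g u) y)).
    rewrite avgD avg_const (avg_sgM (A := [::])) ?addr0 //.
  by move=> x; rewrite big_nil !mul1r big_seq1.
move: h; rewrite (negbTE s0) /= => /eqP /count1_filter [p Ep ps]; rewrite Ep.
pose g' : T -> wtree I (T * T) :=
  fun b => if b == p then Join (g p) (Edge (u, p) (g u)) else g b.
rewrite -/g' -IH //.
pose h g x := list_prod e' (edge_factor x) (map f s) * \prod_(u <- s) gadget g u x.
have dg h' u' : u' \in s -> depends (map f s) (gadget h' u').
  by move=> u's x z exz; rewrite /gadget /sg exz // map_f.
have gp x : gadget g' p x = gadget g p x * F edge_weight (g u) y +
    edge_weight (u, p) * (sg R (f p) x * gadget g p x) * G edge_weight (g u) y.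
  rewrite /gadget /g' eqxx F_Join G_Join F_Edge G_Edge.
  have xx := sg_sqr R (f p) x; move: (sg R (f p) x) xx => z zz.
  set Fp := F _ (g p) y; set Gp := G _ (g p) y; set Fu := F _ _ y; set Gu := G _ _ y.
  set W := edge_weight _.
  transitivity ((Fp + z * Gp) * Fu + W * (z * Fp + (z * z) * Gp) * Gu); last by ring.
  rewrite zz; ring.
(* [D] is the coefficient of the spin of [f u] in the integrand and does not involve that spin, so
   its term averages to zero. *)
pose D x := list_prod e' (edge_factor x) (map f s) * 
  ((edge_weight (u, p) * sg R (f p) x * F edge_weight (g u) y + G edge_weight (g u) y) *
   \prod_(u <- s) gadget g u x).
have depD : depends (map f s) D.
  move=> x z exz; rewrite /D (depends_list_prod exz) /sg (exz (f p)) ?map_f //; congr (_ * (_ * _)).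
  by apply: eq_big_seq => b bs; apply: (dg g b bs).
rewrite (eq_avg (h2 := fun x => h g' x + sg R (f u) x * D x)).
  by rewrite avgD (avg_sgM depD fus) addr0.
move=> x; rewrite /h /D.
have -> : \prod_(b <- map f s | e' (f u) b) edge_factor x (f u) b = edge_factor x (f u) (f p).
  rewrite big_map -big_filter (eq_filter (a2 := e u)) ?Ep ?big_seq1 //.
rewrite big_cons.
have prodE g1 : \prod_(u <- s) gadget g1 u x = gadget g1 p x * \prod_(u <- rem p s) gadget g1 u x.
  by rewrite (perm_big _ (perm_to_rem ps)) big_cons.
have g'E : \prod_(u <- rem p s) gadget g' u x = \prod_(u <- rem p s) gadget g u x.
  apply: eq_big_seq => b; rewrite mem_rem_uniq // inE => /andP[/negbTE bp _].
  by rewrite /gadget /g' bp.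
rewrite !prodE g'E gp {1}/gadget /edge_factor -[w (f u) (f p)]/(edge_weight (u, p)).
have xx := sg_sqr R (f u) x; move: (sg R (f u) x) xx => z zz.
set L := list_prod _ _ _; set P := \prod_(_ <- _) _; set Q := gadget g p x; set W := edge_weight _.
set Fu := F _ _ _; set Gu := G _ _ _; set zp := sg R (f p) x.
transitivity (L * (Q * P) * (Fu + W * zp * (z * z) * Gu) + z * (L * (W * zp * Fu + Gu) * (Q * P))); first by ring.
rewrite zz; ring.
Qed.

End MergeValue.

Definition seed (n m : nat) (W : Type) (u : 'I_(n + m)) : wtree 'I_n W :=
  if split u is inl i then Leaf i else Empty.

Lemma leaves_seed n m W (s : seq 'I_(n + m)) : perm_eq s (enum 'I_(n + m)) ->
  perm_eq (flatten [seq leaves (seed W u) | u <- s]) (enum 'I_n).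
Proof.
pose h (u : 'I_(n + m)) := if split u is inl i then Some i else None.
have -> : flatten [seq leaves (seed W u) | u <- s] = pmap h s.
  by elim: s => //= u s ->; rewrite /seed /h; case: (split u).
move=> ps; apply: uniq_perm.
- apply: (pmap_uniq (g := lshift m)); last by rewrite (perm_uniq ps) enum_uniq.
  by move=> u; rewrite /h /oapp; case: splitP => //= i ui; apply: val_inj.
- exact: enum_uniq.
move=> i; rewrite mem_enum mem_pmap; apply/mapP; exists (lshift m i).
  by rewrite (perm_mem ps) mem_enum.
by rewrite /h (unsplitK (inl i)).
Qed.

(** * The density of the leaf distribution *)

Section LeafDist.
Variables (R : realType) (n m m' : nat) (e : rel 'I_(n + m)) (e' : rel 'I_(n + m')).
Variables (f : 'I_(n + m) -> 'I_(n + m')) (th : 'I_(n + m') -> 'I_(n + m') -> R).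
Variable (s : seq 'I_(n + m)).
Hypotheses (f_bij : bijective f) (f_leaf : forall i, f (lshift m i) = lshift m' i).
Hypotheses (eE : forall a b, e' (f a) (f b) = e a b).
Hypotheses (e'_sym : symmetric e') (e'_irr : irreflexive e').
Hypotheses (s_elim : elim_order e s) (s_perm : perm_eq s (enum 'I_(n + m))).

(** The model reads [th a b] only on edges with a < b. Symmetrising makes the orientation
    irrelevant, and 0 off the edges keeps all weights bounded. *)
Definition sym_weight (a b : 'I_(n + m')) : R :=
  if e' a b then if (a < b)%N then th a b else th b a else 0.

Definition leaf_weight : 'I_(n + m) * 'I_(n + m) -> R := edge_weight f sym_weight.
Definition leaf_tree_of := merge_tree e s (@seed n m ('I_(n + m) * 'I_(n + m))).

Lemma sym_weightC a b : sym_weight a b = sym_weight b a.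
Proof.
rewrite /sym_weight e'_sym; case: ltngtP => // /val_inj ->.
by case: ifP.
Qed.

Lemma sym_weight_le1 : weights_ok e' th -> forall p, `|leaf_weight p| <= 1.
Proof.
move=> ok [a b]; rewrite /leaf_weight /edge_weight /sym_weight /=; case: ifP => E; last by rewrite normr0.
by case: ifP => _; rewrite ler_norml ok // e'_sym.
Qed.

Lemma perm_leaves_tree : perm_eq (leaves leaf_tree_of) (enum 'I_n).
Proof. by apply: perm_trans (leaves_merge _ s_elim) _; apply: leaves_seed. Qed.

Lemma perm_map_f : perm_eq (map f s) (enum 'I_(n + m')).
Proof.
have [g fK gK] := f_bij; apply: uniq_perm (enum_uniq _) _ => [|u].
  by rewrite (map_inj_uniq (can_inj fK)) (perm_uniq s_perm) enum_uniq.
by rewrite mem_enum -[u]gK map_f // (perm_mem s_perm) mem_enum.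
Qed.

Let K : R := \prod_(p : 'I_(n + m') * 'I_(n + m') | (p.1 < p.2)%N && e' p.1 p.2) 2^-1.
Let W x := list_prod e' (edge_factor sym_weight x) (map f s).

Lemma ising_weightE x : ising_weight e' th x = K * W x.
Proof.
rewrite /W list_prodE //; last by move=> a b; rewrite /edge_factor sym_weightC (mulrC (sg R a x)).
rewrite (perm_big _ perm_map_f) big_enum /=.
under eq_bigr do rewrite (perm_big _ perm_map_f) big_enum_cond /=.
rewrite pair_big_dep /= /K -big_split /=; apply: eq_bigr => -[a b] /= /andP[ab eab].
by rewrite /edge_factor /sym_weight eab ab /sg mulrC !mulrA.
Qed.

Lemma K_neq0 : K != 0.
Proof. by apply/prodf_neq0 => p _; rewrite invr_eq0 pnatr_eq0. Qed.

(** Elimination with bare roots at all vertices computes the partition function, and a tree without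
    leaves has [F] equal to 1. *)
Lemma avg_W : avg W = 1.
Proof.
have [g fK _] := f_bij.
have := avg_merge sym_weight (can_inj fK) eE ([ffun=> true] : {ffun 'I_n -> bool}) (fun=> Empty) s_elim.
rewrite F_no_leaf; last first.
  apply: perm_nilP; apply: perm_trans (leaves_merge _ s_elim) _.
  by rewrite (_ : flatten _ = [::]) //; elim: (s).
move=> <-; apply: eq_avg => x; rewrite big1 ?mulr1 // => u _.
by rewrite /gadget /F /G /= mulr0 addr0.
Qed.

Lemma leaf_distE y :
  leaf_dist e' th y = (2 ^+ n)^-1 * F leaf_weight leaf_tree_of y.
Proof.
have [g fK _] := f_bij.
rewrite /leaf_weight /leaf_tree_of -(avg_merge sym_weight (can_inj fK) eE y _ s_elim).
(* A seeded leaf contributes 1 + x_i y_i, twice the indicator of x_i = y_i, so the average sums the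
   weights of the configurations extending [y]. *)
have prod_gadget x : \prod_(u <- s) gadget f sym_weight y (seed _) u x =
    \prod_(i < n) (1 + sg R (lshift m' i) x * sg R i y).
  rewrite (perm_big _ s_perm) big_enum /= big_split_ord /= [X in _ * X]big1 ?mulr1.
    by apply: eq_bigr => i _; rewrite /gadget /seed (unsplitK (inl i)) f_leaf.
  by move=> i _; rewrite /gadget /seed (unsplitK (inr i)) /F /G /= mulr0 addr0.
have indicator x : (2 ^+ n)^-1 * \prod_(i < n) (1 + sg R (lshift m' i) x * sg R i y) =
    ([forall i, x (lshift m' i) == y i])%:R.
  have n0 : (2 : R) ^+ n != 0 by rewrite expf_neq0 // pnatr_eq0.
  case: (boolP [forall i, _]) => [/forallP E | ]; last first.
    rewrite negb_forall => /existsP[i xi]; rewrite (bigD1 i) //= (_ : 1 + _ = 0) ?mul0r ?mulr0 //.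
    by move: xi; rewrite /sg /spin; case: (x _); case: (y i) => //= _; ring.
  rewrite (eq_bigr (fun=> 2)) => [|i _]; first by rewrite prodr_const card_ord mulVf.
  by rewrite (_ : sg R _ x = sg R i y) ?sg_sqr // /sg (eqP (E i)).
have sumW : \sum_x ising_weight e' th x = K * 2 ^+ #|'I_(n + m')|.
  have := avg_W; rewrite /avg => /(congr1 (fun t => K * (2 ^+ #|'I_(n + m')| * t))).
  rewrite mulr1 mulVKf; last by rewrite expf_neq0 // pnatr_eq0.
  by move=> <-; rewrite mulr_sumr; apply: eq_bigr => x _; apply: ising_weightE.
rewrite /leaf_dist /ising_prob sumW /avg mulrCA mulr_sumr mulr_sumr big_mkcond /=.
apply: eq_bigr => x _; rewrite prod_gadget ising_weightE -/(W x).
rewrite [(2 ^+ n)^-1 * _]mulrCA indicator.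
case: ifP => _; last by rewrite !mulr0.
by rewrite mulr1 invfM mulrACA mulfV ?mul1r 1?mulrC // K_neq0.
Qed.

End LeafDist.

(** * Leaf distributions *)

(** The degrees would add up to 1 + 3m, against 2m arcs in a tree on 1 + m vertices. With a single
    leaf the bound on correlations would be vacuous and [eps] could be negative. *)
Lemma leaf_tree_neq1 m (e : rel 'I_(1 + m)) : ~ leaf_tree e.
Proof.
case=> -[_ [_ [_ card]]] [deg1 deg3].
have : (\sum_(u : 'I_(1 + m)) degree e u = 2 * (#|'I_(1 + m)| - 1))%N.
  rewrite -card -sum1_card (eq_bigl (fun p => e p.1 p.2)); last by move=> p; rewrite inE.
  rewrite -(pair_big_dep predT (fun u v => e u v) (fun _ _ => 1%N)) /=.
  by apply: eq_bigr => u _; rewrite /degree -sum1_card; apply: eq_bigl => v; rewrite inE.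
rewrite big_split_ord /= big_ord1 deg1 (eq_bigr (fun=> 3%N)).
  by rewrite sum_nat_const !card_ord; lia.
by move=> i _; apply: deg3.
Qed.

Lemma diameter_gt0 (T : finType) (e : rel T) (u v : T) : u != v -> (0 < diameter e)%N.
Proof.
move=> uv; have d0 : (0 < dist e u v)%N.
  (* The default [#|T|] of the minimum is positive since [u] exists, and radius 0 reaches only
     [u]. *)
  rewrite /dist; elim/big_ind: _ => [|a b a0 b0|[[|k] kT] //=].
  - by apply/card_gt0P; exists u.
  - by rewrite leq_min a0.
  - by rewrite inE eq_sym (negbTE uv).
apply: leq_trans d0 _; apply: leq_trans (leq_bigmax u).
exact: (leq_bigmax v).
Qed.

Section Distances.
Variables (R : realType) (n : nat).

Lemma avg_leaf (h : {ffun 'I_n -> bool} -> R) : avg h = \sum_y (2 ^+ n)^-1 * h y.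
Proof. by rewrite /avg card_ord mulr_sumr. Qed.

Variables (W W' : Type) (v : W -> R) (v' : W' -> R).
Variables (t : wtree 'I_n W) (t' : wtree 'I_n W') (mu nu : {ffun 'I_n -> bool} -> R).
Hypothesis muE : forall y, mu y = (2 ^+ n)^-1 * F v t y.
Hypothesis nuE : forall y, nu y = (2 ^+ n)^-1 * F v' t' y.

Lemma TV_norm1 : TV mu nu = 2^-1 * norm1 (fun y => F v t y - F v' t' y).
Proof.
rewrite /TV /norm1 avg_leaf; congr (_ * _); apply: eq_bigr => y _.
by rewrite muE nuE -mulrBr normrM ger0_norm // invr_ge0 exprn_ge0.
Qed.

Lemma discr_corr i j : discr v v' t t' i j = `|corr mu i j - corr nu i j|.
Proof.
by rewrite /discr /corr /al !avg_leaf; congr (`|_ - _|); apply: eq_bigr => y _;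
   rewrite ?muE ?nuE /sg !mulrA.
Qed.

Lemma discr_bound_ge0 (eps : R) : (1 < n)%N ->
  (forall i j : 'I_n, i != j -> `|corr mu i j - corr nu i j| <= eps) -> 0 <= eps.
Proof.
move=> n1 le_eps; apply: le_trans (le_eps (Ordinal (ltnW n1)) (Ordinal n1) _) => //.
Qed.

Lemma pairsum_le (eps : R) : uniq (leaves t) -> uniq (leaves t') ->
  perm_eq (leaves t) (enum 'I_n) -> n != 1%N ->
  (forall i j : 'I_n, i != j -> `|corr mu i j - corr nu i j| <= eps) ->
  pairsum (discr v v' t t') (leaves t) <= (n ^ 2)%:R * eps.
Proof.
move=> u u' pt n1 le_eps; rewrite (perm_pairsum _ pt) /pairsum.
have [n0|n0] := posnP n.
  by rewrite big_enum /= big1 ?n0 ?mul0r // => i _; have := ltn_ord i; rewrite {2}n0.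
have eps0 : 0 <= eps by apply: discr_bound_ge0 le_eps; case: n n0 n1 => [|[]].
have -> : (n ^ 2)%:R * eps = \sum_(i <- enum 'I_n) \sum_(j <- enum 'I_n) eps.
  have cst (c : R) : \sum_(i <- enum 'I_n) c = c *+ n.
    by rewrite big_const_seq count_predT size_enum_ord iter_addr_0.
  by rewrite !cst -mulrnA mulnn mulr_natl.
apply: ler_sum => i _; apply: ler_sum => j _.
have [->|ij] := eqVneq i j; first by rewrite discr_diag.
by rewrite discr_corr le_eps.
Qed.

End Distances.

Lemma leaf_tree_elim n m (e : rel 'I_(n + m)) : leaf_tree e ->
  exists s, [/\ symmetric e, irreflexive e, elim_order e s & perm_eq s (enum 'I_(n + m))].
Proof.
by case=> /[dup] -[sym [irr _]] /tree_elim [s [ps es]] _; exists s.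
Qed.

Lemma bounded_all (R : realType) (I : finType) W (v : W -> R) (u : wtree I W) :
  (forall w, `|v w| <= 1) -> bounded v u.
Proof. by move=> v1; elim: u => //= [w u -> | u -> u' ->]; rewrite ?v1. Qed.

Lemma leaf_dist_tree (R : realType) n m (e : rel 'I_(n + m)) (th : 'I_(n + m) -> 'I_(n + m) -> R) :
  leaf_tree e -> weights_ok e th ->
  exists t : wtree 'I_n R, [/\ perm_eq (leaves t) (enum 'I_n), bounded idfun t &
    forall y, leaf_dist e th y = (2 ^+ n)^-1 * F idfun t y].
Proof.
move=> /leaf_tree_elim [s [sym irr es ps]] ok.
have id_bij : bijective (@id 'I_(n + m)) by exists id.
exists (map_tree (leaf_weight e id th) (leaf_tree_of e s)); split.
- by rewrite leaves_map; apply: perm_leaves_tree.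
- by rewrite bounded_map; apply: bounded_all; apply: sym_weight_le1.
move=> y; rewrite (leaf_distE th id_bij (fun=> erefl) (fun _ _ => erefl) sym irr es ps).
by rewrite /F msg_map.
Qed.

(** * The two bounds on the total variation *)

Section Bounds.
Variables (R : realType) (n m m' : nat) (e : rel 'I_(n + m)) (e' : rel 'I_(n + m')).
Variables (th : 'I_(n + m) -> 'I_(n + m) -> R) (th' : 'I_(n + m') -> 'I_(n + m') -> R).
Variable eps : R.
Hypotheses (et : leaf_tree e) (et' : leaf_tree e').
Hypotheses (ok : weights_ok e th) (ok' : weights_ok e' th').
Hypothesis le_eps : forall i j : 'I_n, i != j ->
  `|corr (leaf_dist e th) i j - corr (leaf_dist e' th') i j| <= eps.

Lemma leaf_tree_size_neq1 : n != 1%N.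
Proof.
by apply/eqP => n1; move: m e et; rewrite n1 => k ek; apply: leaf_tree_neq1.
Qed.

Lemma TV_same_tree : same_tree e e' ->
  TV (leaf_dist e th) (leaf_dist e' th') <= 2 * (n ^ 2)%:R * eps.
Proof.
move=> [f [f_bij [f_leaf eE]]].
have [s [sym irr es ps]] := leaf_tree_elim et.
have [_ [sym' irr' _ _]] := leaf_tree_elim et'.
have id_bij : bijective (@id 'I_(n + m)) by exists id.
pose t0 := leaf_tree_of e s.
(* Both models are evaluated on one tree: [f] carries the elimination order of [e] to [e'], and each
   edge stores its two weights. *)
pose w p := (leaf_weight e id th p, leaf_weight e' f th' p).
pose t := map_tree w t0.
have muE y : leaf_dist e th y = (2 ^+ n)^-1 * F fst t y.
  by rewrite (leaf_distE th id_bij (fun=> erefl) (fun _ _ => erefl) sym irr es ps) /F /t msg_map.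
have nuE y : leaf_dist e' th' y = (2 ^+ n)^-1 * F snd t y.
  by rewrite (leaf_distE th' f_bij f_leaf eE sym' irr' es ps) /F /t msg_map.
have pt : perm_eq (leaves t) (enum 'I_n) by rewrite leaves_map; apply: perm_leaves_tree.
have ut : uniq (leaves t) by rewrite (perm_uniq pt) enum_uniq.
have b1 : bounded fst t.
  by rewrite bounded_map; apply: bounded_all; apply: sym_weight_le1.
have b2 : bounded snd t.
  by rewrite bounded_map; apply: bounded_all; apply: sym_weight_le1.
rewrite (TV_norm1 muE nuE).
have := norm1_same_shape ut b1 b2.
have := pairsum_le muE nuE ut ut pt leaf_tree_size_neq1 le_eps.
(* This also shows that n^2 * eps is nonnegative, so half of it is at most twice it. *)
have := norm1_ge0 (fun y => F fst t y - F snd t y).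
set N := norm1 _; set P := pairsum _ _; move=> N0 Pe NP; rewrite -mulrA.
lra.
Qed.

(** The constant 1 suffices: the bound obtained is of order n^3 * eps, and it is weakened by D >= 1
    and n^3 <= n^5. *)
Lemma TV_any_tree : TV (leaf_dist e th) (leaf_dist e' th') <=
  1 * (minn (diameter e) (diameter e'))%:R * (n ^ 5)%:R * eps.
Proof.
have [t [pt bt muE]] := leaf_dist_tree et ok.
have [t' [pt' bt' nuE]] := leaf_dist_tree et' ok'.
have ut : uniq (leaves t) by rewrite (perm_uniq pt) enum_uniq.
have ut' : uniq (leaves t') by rewrite (perm_uniq pt') enum_uniq.
have ptt' : perm_eq (leaves t) (leaves t') by rewrite (permPl pt) perm_sym.
rewrite (TV_norm1 muE nuE).
have := norm1_any_shape (ltnSn _) ptt' ut bt bt'.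
have := pairsum_le muE nuE ut ut' pt leaf_tree_size_neq1 le_eps.
have -> : size (leaves t) = n by rewrite (perm_size pt) size_enum_ord.
set N := norm1 _; set P := pairsum _ _ => Pe NP.
have P0 : 0 <= P by apply: pairsum_ge0 => *; apply: normr_ge0.
have [n0|n0] := posnP n.
  have nR : n%:R = 0 :> R by rewrite n0.
  have n5R : (n ^ 5)%:R = 0 :> R by rewrite n0.
  by move: NP; rewrite nR n5R !(mul0r, mulr0); lra.
have n1 : (1 < n)%N by rewrite ltn_neqAle eq_sym leaf_tree_size_neq1.
have eps0 : 0 <= eps by apply: discr_bound_ge0 n1 le_eps.
have D0 : (0 < minn (diameter e) (diameter e'))%N.
  have neq : Ordinal (ltnW n1) != Ordinal n1 :> 'I_n by [].
  by rewrite leq_min (diameter_gt0 e (u := lshift m _) (v := lshift m _) neq)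
    (diameter_gt0 e' (u := lshift m' _) (v := lshift m' _) neq).
have NP' : 2 * N <= (n ^ 3)%:R * eps.
  apply: le_trans NP _; rewrite expnS natrM -mulrA; exact: ler_wpM2l.
apply: (@le_trans _ _ ((n ^ 3)%:R * eps)); first by have := norm1_ge0 (fun y => F idfun t y - F idfun t' y); rewrite -/N; lra.
rewrite mul1r ler_wpM2r // -natrM ler_nat.
by apply: leq_trans (leq_pmull _ D0); rewrite leq_exp2l.
Qed.

End Bounds.

Theorem theorem1 (R : realType) :
  (* (1) same topology *)
  (forall (n m m' : nat) (e : rel 'I_(n + m)) (e' : rel 'I_(n + m'))
          (th : 'I_(n + m) -> 'I_(n + m) -> R)
          (th' : 'I_(n + m') -> 'I_(n + m') -> R) (eps : R),
      leaf_tree e -> leaf_tree e' -> weights_ok e th -> weights_ok e' th' ->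
      same_tree e e' ->
      (forall i j : 'I_n, i != j ->
         `|corr (leaf_dist e th) i j - corr (leaf_dist e' th') i j| <= eps) ->
      TV (leaf_dist e th) (leaf_dist e' th') <= 2 * (n ^ 2)%:R * eps)
  /\
  (* (2) different topologies *)
  (exists C : R, 0 < C /\
    forall (n m m' : nat) (e : rel 'I_(n + m)) (e' : rel 'I_(n + m'))
           (th : 'I_(n + m) -> 'I_(n + m) -> R)
           (th' : 'I_(n + m') -> 'I_(n + m') -> R) (eps : R),
      leaf_tree e -> leaf_tree e' -> weights_ok e th -> weights_ok e' th' ->
      ~ same_tree e e' ->
      (forall i j : 'I_n, i != j ->
         `|corr (leaf_dist e th) i j - corr (leaf_dist e' th') i j| <= eps) ->
      TV (leaf_dist e th) (leaf_dist e' th')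
        <= C * (minn (diameter e) (diameter e'))%:R * (n ^ 5)%:R * eps).
Proof.
split; first by move=> *; apply: TV_same_tree.
by exists 1; split=> [|n m m' e e' th th' eps *]; [rewrite ltr01 | apply: TV_any_tree].
Qed.
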